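(* Let $Q$ be the quiver of type $\tilde A_{n,1}$ ($n\ge1$). Then the set of integers $l\ge0$ such that $Q$ admits a maximal green sequence of length $l$ is exactly the integer interval $\{n+1,n+2,\dots,\frac{n(n+3)}{2}\}$.
   Context: $Q$ has vertices $0,1,\dots,n$, arrows $k-1\to k$ for $1\le k\le n$, and one additional arrow $0\to n$. For a cluster quiver $Q$ (finite, connected, no loops or oriented 2-cycles), the framed quiver $\hat Q$ is obtained by adding, for each vertex $i$, a new frozen vertex $c(i)$ and an arrow $i\to c(i)$. Mutation $\mu_k$ at a non-frozen vertex $k$: (1) for every pair of arrows $i\to k\to j$ add an arrow $i\to j$; (2) reverse every arrow incident to $k$; (3) remove a maximal collection of oriented 2-cycles and all arrows between frozen vertices. In a quiver obtained from $\hat Q$ by iterated mutations at non-frozen vertices, a non-frozen vertex $i$ is green if there is no arrow from a frozen vertex to $i$. A green sequence is a sequence $(i_1,\dots,i_l)$ of vertices of $Q$ such that $i_1$ is green in $\hat Q$ and $i_k$ is green in $\mu_{i_{k-1}}\cdots\mu_{i_1}\hat Q$ for $2\le k\le l$; its length is $l$; it is maximal if $\mu_{i_l}\cdots\mu_{i_1}\hat Q$ has no green vertex. *)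

(* Defs.v *)
From mathcomp Require Import all_boot.
Set Implicit Arguments. Unset Strict Implicit. Unset Printing Implicit Defensive.

(* A quiver is given by its arrow-multiplicity function: [q i j] is the number
   of arrows i -> j.  A cluster quiver [Q] on m vertices uses the vertices
   0, ..., m-1.  Its framed quiver uses in addition the frozen vertices
   c(i) := m + i  (0 <= i < m). *)
Definition quiver := nat -> nat -> nat.

Definition frozen (m : nat) (v : nat) : bool := m <= v.

Definition frame (m : nat) (i : nat) : nat := m + i.

Definition framed (m : nat) (Q : quiver) : quiver :=
  fun i j => if (i < m) && (j < m) then Q i j
             else ((i < m) && (j == frame m i) : nat).

(* Mutation at the (non-frozen) vertex k, following the three steps:
   (1) for every pair i -> k -> j add an arrow i -> j;
   (2) reverse all arrows incident to k;
   (3) remove a maximal collection of oriented 2-cycles and all arrows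
       between frozen vertices. *)
Definition mut_step12 (k : nat) (q : quiver) : quiver :=
  fun i j =>
    if i == k then q j k
    else if j == k then q k i
    else q i j + q i k * q k j.

Definition mutate (m : nat) (k : nat) (q : quiver) : quiver :=
  fun i j =>
    if frozen m i && frozen m j then 0
    else mut_step12 k q i j - mut_step12 k q j i.

Definition mutate_seq (m : nat) (s : seq nat) (q : quiver) : quiver :=
  foldl (fun q k => mutate m k q) q s.

Definition green (m : nat) (q : quiver) (i : nat) : bool :=
  [forall j : 'I_m, q (frame m j) i == 0].

Fixpoint green_from (m : nat) (q : quiver) (s : seq nat) : bool :=
  match s with
  | [::] => true
  | k :: s' => [&& k < m, green m q k & green_from m (mutate m k q) s']
  end.

Definition green_sequence (m : nat) (Q : quiver) (s : seq nat) : bool :=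
  green_from m (framed m Q) s.

Definition maximal_green_sequence (m : nat) (Q : quiver) (s : seq nat) : bool :=
  green_sequence m Q s &&
  [forall i : 'I_m, ~~ green m (mutate_seq m s (framed m Q)) i].

(* The quiver of type \tilde A_{n,1}: vertices 0..n, arrows k-1 -> k for
   1 <= k <= n, and one additional arrow 0 -> n.  (For n = 1 this gives two
   arrows 0 -> 1.)  It has n+1 vertices. *)
Definition quiver_A_tilde_n1 (n : nat) : quiver :=
  fun i j => ((i.+1 == j) && (j <= n) : nat) + ((i == 0) && (j == n) : nat).

(* Main.v *)
From Stdlib Require Import ZArith Lia.
Require Import Defs.
From mathcomp Require Import all_boot.
From mathcomp Require Import zify_ssreflect.

(* Q is the quiver of a fan triangulation of an annulus with n marked points on the outer
   boundary, lifted to the integers of the universal cover, and one marked point p on the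
   inner boundary.  Mutations are flips.  A triangulation amounts to the least outer point
   i_0 joined to (a fixed lift of) p and a triangulation of the polygon i_0, ..., i_0 + n,
   p, i.e. a spine of binary trees.  The c-vectors are shear coordinates, given by explicit
   formulas, from which one reads off which flips are green:
   - between outer points a < b < c < d, the flip of bd to ac;
   - the removal of an arc bp if b <= n and its creation if b > n;
   - replacing i_0 by the next outer point joined to p (a rotation of the spine) if i_0 <= n
     and the latter is positive;
   - the inverse rotation if i_0 <= 0 or if the last-but-one arc starts beyond 2n.
   An integer potential drops at each green flip; it is n(n+3)/2 initially and at least 0 at
   the end of a maximal green sequence, which gives the upper bound.  The lower bound holds
   because a vertex that is never mutated stays green.  Every length in between is written
   uniquely as n + 1 + m(m+1)/2 + r with 0 <= r <= m < n and realised by an explicit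
   path. *)

Set Implicit Arguments.

Open Scope Z_scope.

Local Arguments Z.add : simpl never.
Local Arguments Z.sub : simpl never.
Local Arguments Z.mul : simpl never.

(** * Triangulated polygons *)

(* Node k l r is the triangle just below the arc labelled k, and l, r are what lies below
   its two other sides (a Leaf is a boundary segment).  The vertices of the polygon are
   consecutive integers, and the in-order position of a node is the middle vertex of its
   triangle; a tree starting at a has positions a+1, a+2, ... *)
Inductive tree := Leaf | Node of nat & tree & tree.

Fixpoint tnodes (t : tree) : Z :=
  if t is Node _ l r then tnodes l + tnodes r + 1 else 0.

Definition troot (t : tree) : option nat := if t is Node k _ _ then Some k else None.

(** A boundary side [None] is not a vertex of the quiver and contributes 0 everywhere. *)
Definition ind (o : option nat) (i : nat) : Z := if o == Some i then 1 else 0.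

Arguments ind : simpl never.

Fixpoint tcount (t : tree) (i : nat) : Z :=
  if t is Node k l r then ind (Some k) i + tcount l i + tcount r i else 0.

(* Signed adjacency of the 3-cycle a -> b -> c -> a; None is a boundary side. *)
Definition triangle (a b c : option nat) (i j : nat) : Z :=
  ind a i * ind b j + ind b i * ind c j + ind c i * ind a j
  - (ind a j * ind b i + ind b j * ind c i + ind c j * ind a i).

Fixpoint tarrows (t : tree) (i j : nat) : Z :=
  if t is Node k l r
  then triangle (Some k) (troot r) (troot l) i j + tarrows l i j + tarrows r i j
  else 0.

Lemma tnodes_ge0 t : 0 <= tnodes t.
Proof. by elim: t => [|k l Hl r Hr] /=; lia. Qed.

Lemma ind_Some k i : ind (Some k) i = if k == i then 1 else 0.
Proof. by []. Qed.

Lemma ind_bounds o i : 0 <= ind o i <= 1.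
Proof. by rewrite /ind; case: eqP; lia. Qed.

Lemma ind_id k : ind (Some k) k = 1.
Proof. by rewrite /ind eqxx. Qed.

Lemma ind_neq k j : k != j -> ind (Some k) j = 0.
Proof. by move=> kj; rewrite /ind; case: eqP => // -[/eqP]; rewrite (negbTE kj). Qed.

Lemma ind_None j : ind None j = 0.
Proof. by []. Qed.

Lemma tcount_ge0 t i : 0 <= tcount t i.
Proof. by elim: t => [|k l Hl r Hr] //=; have := ind_bounds (Some k) i; lia. Qed.

Lemma root_count t i : ind (troot t) i <= tcount t i.
Proof.
by case: t => [|k l r] //=; have := tcount_ge0 l i; have := tcount_ge0 r i; lia.
Qed.

Lemma triangle_anti a b c i j : triangle a b c j i = - triangle a b c i j.
Proof. rewrite /triangle; ring. Qed.

Lemma triangle_absent a b c i k :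
  ind a k = 0 -> ind b k = 0 -> ind c k = 0 -> triangle a b c i k = 0.
Proof. by rewrite /triangle => -> -> ->; ring. Qed.

Lemma tarrows_anti t i j : tarrows t j i = - tarrows t i j.
Proof. by elim: t => [|k l Hl r Hr] //=; rewrite triangle_anti Hl Hr; lia. Qed.

Lemma tarrows_absent t i k : tcount t k = 0 -> tarrows t i k = 0.
Proof.
elim: t => [|x l Hl r Hr] //= H.
have [? ? ? ? ?] : [/\ ind (Some x) k = 0, tcount l k = 0, tcount r k = 0,
   ind (troot l) k = 0 & ind (troot r) k = 0].
  have := ind_bounds (Some x) k; have := tcount_ge0 l k; have := tcount_ge0 r k.
  have := root_count l k; have := root_count r k.
  by have := ind_bounds (troot l) k; have := ind_bounds (troot r) k; split; lia.
by rewrite triangle_absent // Hl // Hr.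
Qed.

(* B' is the mutation of the signed adjacency B at k, where I i and O i count the arrows
   i -> k and k -> i. *)
Definition exchange (k : nat) (I O : nat -> Z) (B B' : nat -> nat -> Z) : Prop :=
  [/\ I k = 0 /\ O k = 0,
      forall i, B i k = I i - O i /\ B' i k = O i - I i,
      forall i j, B j i = - B i j /\ B' j i = - B' i j &
      forall i j, i != k -> j != k -> B' i j = B i j + I i * O j - I j * O i].

(** Mutation creates I1 -> O1 and I2 -> O2, which cancel sides of the old triangles, and I1 -> O2
    and I2 -> O1, which are sides of the new ones. *)
Lemma exchange_triangles k O1 I1 O2 I2 (B B' : nat -> nat -> Z) :
  ind O1 k = 0 -> ind I1 k = 0 -> ind O2 k = 0 -> ind I2 k = 0 ->
  (forall i j, B i j = triangle (Some k) O1 I1 i j + triangle (Some k) O2 I2 i j) ->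
  (forall i j, B' i j = triangle (Some k) I1 O2 i j + triangle (Some k) I2 O1 i j) ->
  exchange k (fun i => ind I1 i + ind I2 i) (fun i => ind O1 i + ind O2 i) B B'.
Proof.
move=> o1 i1 o2 i2 HB HB'; split.
- by rewrite o1 i1 o2 i2.
- by move=> i; rewrite HB HB' /triangle ind_id o1 i1 o2 i2; split; ring.
- by move=> i j; rewrite !HB !HB' !(triangle_anti _ _ _ i j); split; ring.
- move=> i j; rewrite eq_sym => ik; rewrite eq_sym => jk.
  by rewrite HB HB' /triangle !ind_neq //; ring.
Qed.

(** A summand [r] without arrows at [k] survives the mutation unchanged, so a flip need only be
    checked in the quadrilateral around [k]. *)
Lemma exchange_add k I O (B B' r C C' : nat -> nat -> Z) :
  exchange k I O B B' ->
  (forall i, r i k = 0) -> (forall i j, r j i = - r i j) ->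
  (forall i j, C i j = B i j + r i j) -> (forall i j, C' i j = B' i j + r i j) ->
  exchange k I O C C'.
Proof.
move=> [Hk Hc Ha He] r0 ra HC HC'; split=> //.
- by move=> i; rewrite HC HC' r0; case: (Hc i) => -> ->; split; ring.
- by move=> i j; rewrite !HC !HC' ra; case: (Ha i j) => -> ->; split; ring.
- by move=> i j ik jk; rewrite HC HC' He //; ring.
Qed.

(* A green flip of the arc k.  Here and below, O1, I1, O2, I2 are the sides of the two
   triangles (k, O1, I1) and (k, O2, I2) adjacent to k; the flip replaces them by
   (k, I1, O2) and (k, I2, O1). *)
Inductive rotation (k : nat) :
  option nat -> option nat -> option nat -> option nat -> tree -> tree -> Prop :=
| rot_here p s l r :
    rotation k (troot r) (troot l) (troot s) (Some p)
      (Node p s (Node k l r)) (Node p (Node k s l) r)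
| rot_left q l l' r O1 I1 O2 I2 :
    rotation k O1 I1 O2 I2 l l' -> rotation k O1 I1 O2 I2 (Node q l r) (Node q l' r)
| rot_right q l r r' O1 I1 O2 I2 :
    rotation k O1 I1 O2 I2 r r' -> rotation k O1 I1 O2 I2 (Node q l r) (Node q l r').

Section Rotation.

Context (k : nat) (O1 I1 O2 I2 : option nat) (t t' : tree).
Context (rot : rotation k O1 I1 O2 I2 t t').

Lemma rotation_root : troot t' = troot t.
Proof. by case: rot. Qed.

Lemma rotation_size : tnodes t' = tnodes t.
Proof. by elim: rot => /= *; lia. Qed.

Lemma rotation_count i : tcount t' i = tcount t i.
Proof. by elim: rot => /= *; lia. Qed.

(** When labels are unique, this says that [k] is not the root, hence not a side of the triangle
    above [t]. *)
Lemma rotation_nonroot : ind (troot t) k + 1 <= tcount t k.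
Proof.
elim: rot => /= [p s l r|q l l' r *|q l r r' *]; rewrite ?ind_id.
- by have := tcount_ge0 s k; have := tcount_ge0 l k; have := tcount_ge0 r k; lia.
- by have := tcount_ge0 r k; have := ind_bounds (troot l) k; lia.
- by have := tcount_ge0 l k; have := ind_bounds (troot r) k; lia.
Qed.

(** When labels are unique, this says that [k] and the non-boundary sides of its quadrilateral are
    distinct arcs of [t]. *)
Lemma rotation_labels i :
  ind (Some k) i + ind O1 i + ind I1 i + ind O2 i + ind I2 i <= tcount t i.
Proof.
elim: rot => /= [p s l r|q l l' r *|q l r r' *].
- by have := root_count s i; have := root_count l i; have := root_count r i; lia.
- by have := tcount_ge0 r i; have := ind_bounds (Some q) i; lia.
- by have := tcount_ge0 l i; have := ind_bounds (Some q) i; lia.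
Qed.

End Rotation.

Ltac labels_at t i :=
  let H1 := fresh in let H2 := fresh in let H3 := fresh in
  pose proof (tcount_ge0 t i) as H1; pose proof (root_count t i) as H2;
  pose proof (ind_bounds (troot t) i) as H3.

Lemma rotation_exchange k O1 I1 O2 I2 t t' :
  rotation k O1 I1 O2 I2 t t' -> (forall i, tcount t i <= 1) ->
  exchange k (fun i => ind I1 i + ind I2 i) (fun i => ind O1 i + ind O2 i)
    (tarrows t) (tarrows t').
Proof.
elim=> {t t' O1 I1 O2 I2} [p s l r|q l l' r O1 I1 O2 I2 rt IH|q l r r' O1 I1 O2 I2 rt IH] U.
- have := U k; rewrite /= ind_id.
  have := ind_bounds (Some p) k; labels_at s k; labels_at l k; labels_at r k => ? ?.
  apply: (@exchange_add _ _ _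
    (fun i j => triangle (Some k) (troot r) (troot l) i j
              + triangle (Some k) (troot s) (Some p) i j)
    (fun i j => triangle (Some k) (troot l) (troot s) i j
              + triangle (Some k) (Some p) (troot r) i j)
    (fun i j => tarrows s i j + tarrows l i j + tarrows r i j)).
  + by apply: exchange_triangles => //; lia.
  + by move=> i; rewrite !tarrows_absent //; lia.
  + by move=> i j; rewrite !(tarrows_anti _ i j); lia.
  + by move=> i j /=; rewrite /triangle; ring.
  + by move=> i j /=; rewrite /triangle; ring.
- have Uk := U k; have Nr := rotation_nonroot rt; move: Uk => /= Uk.
  have := ind_bounds (Some q) k; labels_at l k; labels_at r k => ?.
  apply: (@exchange_add _ _ _ (tarrows l) (tarrows l')
    (fun i j => triangle (Some q) (troot r) (troot l) i j + tarrows r i j)).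
  + apply: IH => i; have := U i => /=; have := ind_bounds (Some q) i.
    by have := tcount_ge0 r i; lia.
  + by move=> i; rewrite triangle_absent ?tarrows_absent //; lia.
  + by move=> i j; rewrite triangle_anti (tarrows_anti _ i j); lia.
  + by move=> i j /=; lia.
  + by move=> i j /=; rewrite (rotation_root rt); lia.
- have Uk := U k; have Nr := rotation_nonroot rt; move: Uk => /= Uk.
  have := ind_bounds (Some q) k; labels_at l k; labels_at r k => ?.
  apply: (@exchange_add _ _ _ (tarrows r) (tarrows r')
    (fun i j => triangle (Some q) (troot r) (troot l) i j + tarrows l i j)).
  + apply: IH => i; have := U i => /=; have := ind_bounds (Some q) i.
    by have := tcount_ge0 l i; lia.
  + by move=> i; rewrite triangle_absent ?tarrows_absent //; lia.
  + by move=> i j; rewrite triangle_anti (tarrows_anti _ i j); lia.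
  + by move=> i j /=; lia.
  + by move=> i j /=; rewrite (rotation_root rt); lia.
Qed.

(* Values at one frozen vertex of the c-vectors of the arcs of a polygon whose leftmost
   vertex is a; X b is the height of vertex b and e the height of the middle vertex of
   the triangle above the root arc. *)
Fixpoint tvec (X : Z -> Z) (c : nat -> Z) (a e : Z) (t : tree) : Prop :=
  if t is Node k l r then
    let b := a + tnodes l + 1 in
    [/\ c k = X b - e, tvec X c a (X b) l & tvec X c b (X b) r]
  else True.

(** Mutation of c-vectors at a green vertex: as [c k] >= 0, its value is passed on along the arrows
    into [k] only. *)
Definition cmut (k : nat) (I : nat -> Z) (c : nat -> Z) (j : nat) : Z :=
  if j == k then - c k else c j + I j * c k.

Lemma cmut_id k I c : cmut k I c k = - c k.
Proof. by rewrite /cmut eqxx. Qed.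

Lemma cmut_neq k I c j : ind (Some k) j = 0 -> cmut k I c j = c j + I j * c k.
Proof. by rewrite /cmut; case: eqP => // ->; rewrite ind_id. Qed.

Lemma tvec_ext X c c' a e t :
  (forall j, 0 < tcount t j -> c' j = c j) -> tvec X c a e t -> tvec X c' a e t.
Proof.
elim: t a e => [|k l IHl r IHr] a e //= H [ck cl cr]; split.
- rewrite H ?ind_id //.
  by have := tcount_ge0 l k; have := tcount_ge0 r k; lia.
- apply: IHl => // j ?; apply: H.
  by have := ind_bounds (Some k) j; have := tcount_ge0 r j; lia.
- apply: IHr => // j ?; apply: H.
  by have := ind_bounds (Some k) j; have := tcount_ge0 l j; lia.
Qed.

(** Only the root sees the height [e] of the vertex above, so adding d to its value amounts to
    replacing [e] by [e - d]. *)
Lemma tvec_root X c c' a e d t :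
  (forall j, tcount t j <= 1) ->
  (forall j, 0 < tcount t j -> c' j = c j + ind (troot t) j * d) ->
  tvec X c a e t -> tvec X c' a (e - d) t.
Proof.
case: t => [|k l r] //= U H [ck cl cr].
have same s : (forall j, ind (Some k) j + tcount s j <= 1) ->
    (forall j, tcount s j <= tcount (Node k l r) j) ->
    forall j, 0 < tcount s j -> c' j = c j.
  move=> Us Hs j jp; have := Hs j; have := Us j; have := ind_bounds (Some k) j => /= *.
  rewrite H; last lia.
  have -> : ind (Some k) j = 0 by lia.
  lia.
split.
- rewrite H ?ck ?ind_id; first lia.
  by have := tcount_ge0 l k; have := tcount_ge0 r k; lia.
- apply: tvec_ext cl; apply: same => j; have := U j; have := tcount_ge0 r j;
  by have := ind_bounds (Some k) j; rewrite /=; lia.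
- apply: tvec_ext cr; apply: same => j; have := U j; have := tcount_ge0 l j;
  by have := ind_bounds (Some k) j; rewrite /=; lia.
Qed.

Lemma tvec_shift X s z c a e t :
  (forall b, X (b + s) = X b + z) -> tvec X c a e t -> tvec X c (a + s) (e + z) t.
Proof.
move=> Xs; elim: t a e => [|k l IHl r IHr] a e //= [ck cl cr].
have -> : a + s + tnodes l + 1 = a + tnodes l + 1 + s by lia.
by rewrite Xs; split; [lia|exact: IHl|exact: IHr].
Qed.

Arguments tvec_shift {X s z c a e t}.

(** Let b < d be the middle vertices below [p] and [k], so that [c k] is X d - X b. After the flip,
    d is below [p] and b below [k]; hence [p] and the root of [l], the arcs with an arrow into [k],
    gain X d - X b, and [k] changes sign. *)
Lemma rotation_vec X c k O1 I1 O2 I2 t t' :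
  rotation k O1 I1 O2 I2 t t' -> (forall i, tcount t i <= 1) ->
  forall a e, tvec X c a e t ->
  tvec X (cmut k (fun i => ind I1 i + ind I2 i) c) a e t'.
Proof.
elim=> {t t' O1 I1 O2 I2} [p s l r|q l l' r O1 I1 O2 I2 rt IH|q l r r' O1 I1 O2 I2 rt IH] U a e.
- move=> /= [cp cs [ck cl cr]].
  set b := a + tnodes s + 1 in cp cs ck cl cr *; set d := b + tnodes l + 1 in ck cl cr.
  have -> : a + (tnodes s + tnodes l + 1) + 1 = d by lia.
  have Uj j := U j; move: Uj => /= Uj.
  have same j : ind (Some k) j = 0 -> ind (troot l) j = 0 -> ind (Some p) j = 0 ->
    cmut k (fun i => ind (troot l) i + ind (Some p) i) c j = c j.
    by move=> ? i1 i2; rewrite cmut_neq // i1 i2; lia.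
  split.
  + have := Uj p; rewrite ind_id => Up.
    have := ind_bounds (Some k) p; labels_at s p; labels_at l p; labels_at r p => ?.
    rewrite cmut_neq; last lia.
    have -> : ind (troot l) p = 0 by lia.
    by rewrite ind_id cp ck; lia.
  + split.
    * by rewrite cmut_id ck; lia.
    * apply: tvec_ext cs => j ?; have := Uj j.
      have := ind_bounds (Some k) j; have := ind_bounds (Some p) j.
      by labels_at l j; labels_at r j => *; apply: same; lia.
    * have -> : X b = X d - (X d - X b) by lia.
      apply: tvec_root cl.
        move=> j; have := Uj j; have := ind_bounds (Some k) j; have := ind_bounds (Some p) j.
        by labels_at r j; labels_at s j; lia.
      move=> j ?; have := Uj j.
      have := ind_bounds (Some k) j; have := ind_bounds (Some p) j.
      labels_at r j; labels_at s j => *; rewrite cmut_neq; last lia.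
      have -> : ind (Some p) j = 0 by lia.
      by rewrite ck; lia.
  + apply: tvec_ext cr => j ?; have := Uj j.
    have := ind_bounds (Some k) j; have := ind_bounds (Some p) j.
    by labels_at l j; labels_at s j => *; apply: same; lia.
- move=> /= [cq cl cr]; rewrite (rotation_size rt).
  have same j : tcount l j = 0 ->
    cmut k (fun i => ind I1 i + ind I2 i) c j = c j.
    move=> l0; have := rotation_labels rt j.
    have := ind_bounds (Some k) j; have := ind_bounds I1 j; have := ind_bounds I2 j.
    have := ind_bounds O1 j; have := ind_bounds O2 j => *.
    rewrite cmut_neq; last lia.
    have -> : ind I1 j + ind I2 j = 0 by lia.
    lia.
  split.
  + rewrite same //; have := U q; rewrite /= ind_id.
    by have := tcount_ge0 l q; have := tcount_ge0 r q; lia.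
  + apply: IH => // j; have := U j; rewrite /=.
    by have := ind_bounds (Some q) j; have := tcount_ge0 r j; lia.
  + apply: tvec_ext cr => j ?; apply: same; have := U j; rewrite /=.
    by have := ind_bounds (Some q) j; have := tcount_ge0 l j; lia.
- move=> /= [cq cl cr].
  have same j : tcount r j = 0 ->
    cmut k (fun i => ind I1 i + ind I2 i) c j = c j.
    move=> l0; have := rotation_labels rt j.
    have := ind_bounds (Some k) j; have := ind_bounds I1 j; have := ind_bounds I2 j.
    have := ind_bounds O1 j; have := ind_bounds O2 j => *.
    rewrite cmut_neq; last lia.
    have -> : ind I1 j + ind I2 j = 0 by lia.
    lia.
  split.
  + rewrite same //; have := U q; rewrite /= ind_id.
    by have := tcount_ge0 l q; have := tcount_ge0 r q; lia.
  + apply: tvec_ext cl => j ?; apply: same; have := U j; rewrite /=.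
    by have := ind_bounds (Some q) j; have := tcount_ge0 r j; lia.
  + apply: IH => // j; have := U j; rewrite /=.
    by have := ind_bounds (Some q) j; have := tcount_ge0 l j; lia.
Qed.

(** * The arcs ending at p *)

(* The i-th entry (k, t) consists of the i-th arc k from the outer boundary to p, counted
   from the left, and the polygon t between this arc and the following one. *)
Definition spine := seq (nat * tree).

Fixpoint snodes (sp : spine) : Z :=
  if sp is e :: sp' then tnodes e.2 + 1 + snodes sp' else 0.

Fixpoint scount (sp : spine) (i : nat) : Z :=
  if sp is e :: sp' then ind (Some e.1) i + tcount e.2 i + scount sp' i else 0.

Definition lead (sp : spine) (x : nat) : nat := if sp is e :: _ then e.1 else x.

Fixpoint sarrows (sp : spine) (x : nat) (i j : nat) : Z :=
  if sp is e :: sp' then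
    triangle (Some e.1) (Some (lead sp' x)) (troot e.2) i j + tarrows e.2 i j
    + sarrows sp' x i j
  else 0.

(* The spine counterpart of tvec: b is the outer endpoint of the leading arc, and h is
   max (X a) 1 where a is the outer endpoint of the preceding arc, or 1 + min (X b) 0 when
   the leading arc is the first one (see cvec). *)
Fixpoint svec (X : Z -> Z) (c : nat -> Z) (h b : Z) (sp : spine) (P : Z -> Z -> Prop) : Prop :=
  if sp is e :: sp' then
    let d := b + tnodes e.2 + 1 in
    [/\ c e.1 = Z.min (X d) 1 + h - X b - 1,
        tvec X c b (Z.min (X d) 1 + Z.max (X b) 1 - 1) e.2 &
        svec X c (Z.max (X b) 1) d sp' P]
  else P h b.

(* Arcs from b to p are to be removed when b <= N and to be created when b > N. *)
Inductive smove (N : Z) (x k : nat) :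
  option nat -> option nat -> option nat -> option nat -> Z -> spine -> spine -> Prop :=
| sm_rot b p t t' sp O1 I1 O2 I2 :
    rotation k O1 I1 O2 I2 t t' ->
    smove N x k O1 I1 O2 I2 b ((p, t) :: sp) ((p, t') :: sp)
| sm_close b p s l sp :
    b + tnodes s + 1 <= N ->
    smove N x k (Some (lead sp x)) (troot l) (troot s) (Some p)
      b ((p, s) :: (k, l) :: sp) ((p, Node k s l) :: sp)
| sm_open b p s l sp :
    N + 1 <= b + tnodes s + 1 ->
    smove N x k (troot l) (troot s) (Some p) (Some (lead sp x))
      b ((p, Node k s l) :: sp) ((p, s) :: (k, l) :: sp)
| sm_cons b e sp sp' O1 I1 O2 I2 :
    smove N x k O1 I1 O2 I2 (b + tnodes e.2 + 1) sp sp' ->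
    smove N x k O1 I1 O2 I2 b (e :: sp) (e :: sp').

Lemma snodes_ge0 sp : 0 <= snodes sp.
Proof. by elim: sp => [|e sp IH] //=; have := tnodes_ge0 e.2; lia. Qed.

Lemma scount_ge0 sp i : 0 <= scount sp i.
Proof.
elim: sp => [|e sp IH] //=.
by have := tcount_ge0 e.2 i; have := ind_bounds (Some e.1) i; lia.
Qed.

Lemma lead_count sp x i : ind (Some (lead sp x)) i <= scount sp i + ind (Some x) i.
Proof.
case: sp => [|e sp] //=; first lia.
by have := tcount_ge0 e.2 i; have := ind_bounds (Some x) i; have := scount_ge0 sp i; lia.
Qed.

Lemma sarrows_anti sp x i j : sarrows sp x j i = - sarrows sp x i j.
Proof.
by elim: sp => [|e sp IH] //=; rewrite triangle_anti IH (tarrows_anti _ i j); lia.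
Qed.

Lemma sarrows_rcons sp x y t i j :
  sarrows (rcons sp (x, t)) y i j
  = sarrows sp x i j + triangle (Some x) (Some y) (troot t) i j + tarrows t i j.
Proof.
elim: sp => [|e sp IH] /=; first lia.
have -> : lead (rcons sp (x, t)) y = lead sp x by case: (sp).
rewrite IH; lia.
Qed.

Lemma snodes_cat sp sp' : snodes (sp ++ sp') = snodes sp + snodes sp'.
Proof. by elim: sp => [|e sp IH] //=; rewrite IH; lia. Qed.

Lemma scount_cat sp sp' i : scount (sp ++ sp') i = scount sp i + scount sp' i.
Proof. by elim: sp => [|e sp IH] //=; rewrite IH; lia. Qed.

Lemma sarrows_absent sp x i k :
  scount sp k = 0 -> ind (Some x) k = 0 -> sarrows sp x i k = 0.
Proof.
elim: sp => [|e sp IH] //= H x0.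
have := scount_ge0 sp k; have := lead_count sp x k; have := ind_bounds (Some e.1) k.
labels_at e.2 k; have := ind_bounds (Some (lead sp x)) k => *.
by rewrite triangle_absent ?tarrows_absent ?IH //; lia.
Qed.

Ltac slabels_at sp x i :=
  let H1 := fresh in let H2 := fresh in let H3 := fresh in
  pose proof (scount_ge0 sp i) as H1; pose proof (lead_count sp x i) as H2;
  pose proof (ind_bounds (Some (lead sp x)) i) as H3.

Section SpineMove.

Context (N : Z) (x k : nat) (O1 I1 O2 I2 : option nat) (b : Z) (sp sp' : spine).
Context (mv : smove N x k O1 I1 O2 I2 b sp sp').

Lemma smove_lead : lead sp' x = lead sp x.
Proof. by case: mv. Qed.

Lemma smove_size : snodes sp' = snodes sp.
Proof.
elim: mv => /= [? p t t' s ? ? ? ? rt|? p s l s' H|? p s l s' H|? e s s' ? ? ? ? _ IH]; try lia.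
by rewrite (rotation_size rt).
Qed.

Lemma smove_count i : scount sp' i = scount sp i.
Proof.
elim: mv => /= [? p t t' s ? ? ? ? rt|? p s l s' H|? p s l s' H|? e s s' ? ? ? ? _ IH]; try lia.
by rewrite (rotation_count rt).
Qed.

Lemma smove_nonlead : ind (Some (lead sp x)) k + 1 <= scount sp k.
Proof.
elim: mv => /= [? p t t' s ? ? ? ? rt|? p s l s' H|? p s l s' H|? e s s' ? ? ? ? _ IH];
  rewrite ?ind_id.
- have := rotation_nonroot rt; labels_at t k; have := scount_ge0 s k; lia.
- by have := tcount_ge0 s k; have := tcount_ge0 l k; have := scount_ge0 s' k; lia.
- by have := tcount_ge0 s k; have := tcount_ge0 l k; have := scount_ge0 s' k; lia.
- by have := tcount_ge0 e.2 k; have := ind_bounds (Some (lead s x)) k; lia.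
Qed.

Lemma smove_labels i :
  ind (Some k) i + ind O1 i + ind I1 i + ind O2 i + ind I2 i
  <= scount sp i + ind (Some x) i.
Proof.
elim: mv => /= [? p t t' s ? ? ? ? rt|? p s l s' H|? p s l s' H|? e s s' ? ? ? ? _ IH].
- have := rotation_labels rt i; have := scount_ge0 s i; have := ind_bounds (Some p) i.
  by have := ind_bounds (Some x) i; lia.
- by labels_at s i; labels_at l i; slabels_at s' x i; lia.
- by labels_at s i; labels_at l i; slabels_at s' x i; lia.
- by have := tcount_ge0 e.2 i; have := ind_bounds (Some e.1) i; lia.
Qed.

End SpineMove.

Lemma smove_exchange N x k O1 I1 O2 I2 b sp sp' :
  smove N x k O1 I1 O2 I2 b sp sp' ->
  (forall i, scount sp i + ind (Some x) i <= 1) ->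
  exchange k (fun i => ind I1 i + ind I2 i) (fun i => ind O1 i + ind O2 i)
    (sarrows sp x) (sarrows sp' x).
Proof.
elim=> {b sp sp' O1 I1 O2 I2}
  [b p t t' sp O1 I1 O2 I2 rt|b p s l sp H|b p s l sp H|b e sp sp' O1 I1 O2 I2 mv IH] U.
- have := U k; rewrite /= => Uk; have := rotation_nonroot rt.
  have := ind_bounds (Some p) k; have := ind_bounds (Some x) k.
  labels_at t k; slabels_at sp x k => *.
  apply: (@exchange_add _ _ _ (tarrows t) (tarrows t')
    (fun i j => triangle (Some p) (Some (lead sp x)) (troot t) i j + sarrows sp x i j)).
  + apply: (rotation_exchange rt) => i; have := U i => /=; have := ind_bounds (Some p) i.
    by have := ind_bounds (Some x) i; have := scount_ge0 sp i; lia.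
  + by move=> i; rewrite triangle_absent ?sarrows_absent //; lia.
  + by move=> i j; rewrite triangle_anti (sarrows_anti _ _ i j); lia.
  + by move=> i j /=; lia.
  + by move=> i j /=; rewrite (rotation_root rt); lia.
- have := U k; rewrite /= ind_id.
  have := ind_bounds (Some p) k; have := ind_bounds (Some x) k.
  labels_at s k; labels_at l k; slabels_at sp x k => *.
  apply: (@exchange_add _ _ _
    (fun i j => triangle (Some k) (Some (lead sp x)) (troot l) i j
              + triangle (Some k) (troot s) (Some p) i j)
    (fun i j => triangle (Some k) (troot l) (troot s) i j
              + triangle (Some k) (Some p) (Some (lead sp x)) i j)
    (fun i j => tarrows s i j + tarrows l i j + sarrows sp x i j)).
  + by apply: exchange_triangles => //; lia.
  + by move=> i; rewrite !tarrows_absent ?sarrows_absent //; lia.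
  + by move=> i j; rewrite !(tarrows_anti _ i j) (sarrows_anti _ _ i j); lia.
  + by move=> i j /=; rewrite /triangle; ring.
  + by move=> i j /=; rewrite /triangle; ring.
- have := U k; rewrite /= ind_id.
  have := ind_bounds (Some p) k; have := ind_bounds (Some x) k.
  labels_at s k; labels_at l k; slabels_at sp x k => *.
  apply: (@exchange_add _ _ _
    (fun i j => triangle (Some k) (troot l) (troot s) i j
              + triangle (Some k) (Some p) (Some (lead sp x)) i j)
    (fun i j => triangle (Some k) (troot s) (Some p) i j
              + triangle (Some k) (Some (lead sp x)) (troot l) i j)
    (fun i j => tarrows s i j + tarrows l i j + sarrows sp x i j)).
  + by apply: exchange_triangles => //; lia.
  + by move=> i; rewrite !tarrows_absent ?sarrows_absent //; lia.
  + by move=> i j; rewrite !(tarrows_anti _ i j) (sarrows_anti _ _ i j); lia.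
  + by move=> i j /=; rewrite /triangle; ring.
  + by move=> i j /=; rewrite /triangle; ring.
- have := U k; rewrite /= => Uk; have := smove_nonlead mv.
  have := ind_bounds (Some e.1) k; have := ind_bounds (Some x) k.
  labels_at e.2 k; slabels_at sp x k => *.
  apply: (@exchange_add _ _ _ (sarrows sp x) (sarrows sp' x)
    (fun i j => triangle (Some e.1) (Some (lead sp x)) (troot e.2) i j + tarrows e.2 i j)).
  + apply: IH => i; have := U i => /=; have := ind_bounds (Some e.1) i.
    by have := tcount_ge0 e.2 i; lia.
  + by move=> i; rewrite triangle_absent ?tarrows_absent //; lia.
  + by move=> i j; rewrite triangle_anti (tarrows_anti _ i j); lia.
  + by move=> i j /=; lia.
  + by move=> i j /=; rewrite (smove_lead mv); lia.
Qed.

Lemma svec_ext X c c' h b sp (P P' : Z -> Z -> Prop) :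
  (forall j, 0 < scount sp j -> c' j = c j) -> (forall h b, P h b -> P' h b) ->
  svec X c h b sp P -> svec X c' h b sp P'.
Proof.
move=> + PP; elim: sp h b => [|e sp IH] h b /= H; first exact: PP.
move=> [ce ct cs]; split.
- rewrite H ?ind_id //.
  by have := tcount_ge0 e.2 e.1; have := scount_ge0 sp e.1; lia.
- apply: tvec_ext ct => j ?; apply: H.
  by have := ind_bounds (Some e.1) j; have := scount_ge0 sp j; lia.
- apply: IH cs => j ?; apply: H.
  by have := ind_bounds (Some e.1) j; have := tcount_ge0 e.2 j; lia.
Qed.

(** [P] is a continuation: it receives the [h] and [b] reached at the end of the spine. *)
Lemma svec_cat X c h b sp sp' P :
  svec X c h b (sp ++ sp') P <-> svec X c h b sp (fun h b => svec X c h b sp' P).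
Proof. by elim: sp h b => [|e sp IH] h b //=; split=> -[? ? /IH]. Qed.

Lemma svec_rcons X c h b sp e P :
  svec X c h b (rcons sp e) P <-> svec X c h b sp (fun h b => svec X c h b [:: e] P).
Proof. by rewrite -cats1; apply: svec_cat. Qed.

Lemma svec_end X c h b sp P :
  svec X c h b sp P <->
  svec X c h b sp (fun h' b' => b' = b + snodes sp /\ P h' b').
Proof.
elim: sp h b => [|e sp IH] h b /=.
  by split=> [|[]//]; split=> //; lia.
have -> : b + (tnodes e.2 + 1 + snodes sp) = b + tnodes e.2 + 1 + snodes sp by lia.
by split=> -[? ? /IH].
Qed.

Lemma svec_last X c h b sp P :
  svec X c h b sp P -> exists2 h', P h' (b + snodes sp) & sp <> [::] -> 1 <= h'.
Proof.
elim: sp h b => [|e sp IH] h b /=; first by exists h => //; rewrite Z.add_0_r.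
have -> : b + (tnodes e.2 + 1 + snodes sp) = b + tnodes e.2 + 1 + snodes sp by lia.
case: sp IH => [_ [_ _ /= Ph]|e' sp IH [_ _ /IH[h' ? H]]].
  by exists (Z.max (X b) 1); [rewrite Z.add_0_r|lia].
by exists h' => // _; apply: H.
Qed.

Arguments svec_last {X c h b sp P}.

(** The formula of [svec] with max (X b - 2) 0 in place of min (X d) 1 - 1, because the last arc
    bounds the triangle around p; it serves as the continuation. *)
Definition last_vec (X : Z -> Z) (c : nat -> Z) (x : nat) (h b : Z) : Prop :=
  c x = h - Z.min (X b) 2.

Lemma svec_lead X c c' x h b d sp :
  (forall j, scount sp j + ind (Some x) j <= 1) ->
  (forall j, 0 < scount sp j + ind (Some x) j ->
     c' j = c j + ind (Some (lead sp x)) j * d) ->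
  svec X c h b sp (last_vec X c x) -> svec X c' (h + d) b sp (last_vec X c' x).
Proof.
case: sp => [|e sp] /= U H.
  by rewrite /last_vec (H x) ind_id; lia.
move=> [ce ct cs].
have same j : ind (Some e.1) j = 0 ->
    0 < tcount e.2 j + scount sp j + ind (Some x) j -> c' j = c j.
  move=> e0 p; rewrite H e0; lia.
split.
- rewrite H ind_id; first lia.
  by have := tcount_ge0 e.2 e.1; have := scount_ge0 sp e.1; have := ind_bounds (Some x) e.1; lia.
- apply: tvec_ext ct => j ?; have := U j; have := ind_bounds (Some e.1) j.
  by have := scount_ge0 sp j; have := ind_bounds (Some x) j => *; apply: same; lia.
- rewrite /last_vec same ?ind_id.
  + apply: svec_ext cs => // j ?; have := U j; have := ind_bounds (Some e.1) j.
    by have := tcount_ge0 e.2 j; have := ind_bounds (Some x) j => *; apply: same; lia.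
  + have := U x; rewrite ind_id; have := ind_bounds (Some e.1) x.
    by have := tcount_ge0 e.2 x; have := scount_ge0 sp x; lia.
  + by have := tcount_ge0 e.2 x; have := scount_ge0 sp x; lia.
Qed.

Lemma svec_ext_last X c c' x h b sp :
  (forall j, 0 < scount sp j + ind (Some x) j -> c' j = c j) ->
  svec X c h b sp (last_vec X c x) -> svec X c' h b sp (last_vec X c' x).
Proof.
move=> H; apply: svec_ext => [j p|h' b'].
  by apply: H; have := ind_bounds (Some x) j; lia.
by rewrite /last_vec H // ind_id; have := scount_ge0 sp x; lia.
Qed.

Lemma cmut_same k I c j : ind (Some k) j = 0 -> I j = 0 -> cmut k I c j = c j.
Proof. by move=> k0 I0; rewrite cmut_neq // I0; lia. Qed.

(** Let c1 be the outer endpoint involved and d the next one. For a removal X c1 <= 1 and [c k] is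
    min (X d) 1 - X c1; for a creation X c1 >= 1 and [c k] is X c1 - max (X b) 1. The arcs with an
    arrow into [k] gain exactly this amount. *)
Lemma smove_vec X N x c k O1 I1 O2 I2 b sp sp' h :
  (forall b, b <= N -> X b <= 1) -> (forall b, N + 1 <= b -> 1 <= X b) ->
  (forall a b, a <= b -> X a <= X b) ->
  smove N x k O1 I1 O2 I2 b sp sp' ->
  (forall i, scount sp i + ind (Some x) i <= 1) ->
  let c' := cmut k (fun i => ind I1 i + ind I2 i) c in
  svec X c h b sp (last_vec X c x) -> svec X c' h b sp' (last_vec X c' x).
Proof.
move=> Xle Xge Xm mv; elim: mv h => {b sp sp' O1 I1 O2 I2}
  [b p t t' sp O1 I1 O2 I2 rt|b p s l sp H|b p s l sp H|b e sp sp' O1 I1 O2 I2 mv IH] h U /=.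
- have Uj j := U j; move: Uj => /= Uj; rewrite (rotation_size rt) => -[cp ct cs].
  have same j : tcount t j = 0 -> cmut k (fun i => ind I1 i + ind I2 i) c j = c j.
    move=> t0; have := rotation_labels rt j.
    have := ind_bounds (Some k) j; have := ind_bounds I1 j; have := ind_bounds I2 j.
    by have := ind_bounds O1 j; have := ind_bounds O2 j => *; apply: cmut_same; lia.
  split.
  + rewrite same //; have := Uj p; rewrite ind_id.
    by have := tcount_ge0 t p; have := scount_ge0 sp p; have := ind_bounds (Some x) p; lia.
  + apply: rotation_vec (rt) _ _ _ ct => j; have := Uj j; have := ind_bounds (Some p) j.
    by have := scount_ge0 sp j; have := ind_bounds (Some x) j; lia.
  + apply: svec_ext_last cs => j ?; apply: same; have := Uj j.
    by have := ind_bounds (Some p) j; have := tcount_ge0 t j; lia.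
- have Uj j := U j; move: Uj => /= Uj [cp cs [ck cl csp]].
  set c1 := b + tnodes s + 1 in H ck cl csp cp cs *; set d := c1 + tnodes l + 1 in csp ck cl.
  have -> : b + (tnodes s + tnodes l + 1) + 1 = d by lia.
  have X1 := Xle _ H; have Xb : X b <= 1 by apply: Xle; have := tnodes_ge0 s; lia.
  have Xd : X c1 <= X d by apply: Xm; have := tnodes_ge0 l; lia.
  have same j : ind (Some k) j = 0 -> ind (troot l) j = 0 -> ind (Some p) j = 0 ->
    cmut k (fun i => ind (troot l) i + ind (Some p) i) c j = c j.
    by move=> ? i1 i2; apply: cmut_same => //; lia.
  have all j : [/\ 0 <= ind (Some k) j, 0 <= ind (Some p) j, 0 <= ind (Some x) j,
       0 <= ind (troot l) j <= tcount l j & 0 <= tcount s j /\ 0 <= scount sp j].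
    have := ind_bounds (Some k) j; have := ind_bounds (Some p) j.
    have := ind_bounds (Some x) j; labels_at l j; have := tcount_ge0 s j.
    by have := scount_ge0 sp j; split; lia.
  split.
  + have := Uj p; have [] := all p; rewrite ind_id => *.
    rewrite cmut_neq; last lia.
    have -> : ind (troot l) p = 0 by lia.
    by rewrite ind_id cp ck; lia.
  + split.
    * rewrite cmut_id ck -/c1; lia.
    * have -> : X c1 = Z.min (X c1) 1 + Z.max (X b) 1 - 1 by lia.
      by apply: tvec_ext cs => j ?; have := Uj j; have [] := all j => *; apply: same; lia.
    * have -> : X c1 = Z.min (X d) 1 + Z.max (X c1) 1 - 1 - (c k) by rewrite ck; lia.
      apply: tvec_root cl => [j|j ?]; have := Uj j; have [] := all j => *; first lia.
      by rewrite cmut_neq; [have -> : ind (Some p) j = 0 by lia|]; lia.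
  + have -> : Z.max (X b) 1 = Z.max (X c1) 1 by lia.
    apply: svec_ext_last csp => j ?; have := Uj j; have [] := all j => *; apply: same; lia.
- have Uj j := U j; move: Uj => /= Uj.
  set c1 := b + tnodes s + 1 in H *.
  have -> : b + (tnodes s + tnodes l + 1) + 1 = c1 + tnodes l + 1 by lia.
  set d := c1 + tnodes l + 1; move=> [cp [ck cs cl] csp].
  have X1 := Xge _ H; have Xb : X b <= X c1 by apply: Xm; have := tnodes_ge0 s; lia.
  have Xd : 1 <= X d by apply: Xge; have := tnodes_ge0 l; lia.
  have all j : [/\ 0 <= ind (Some k) j, 0 <= ind (Some p) j, 0 <= ind (Some x) j,
       0 <= ind (troot l) j <= tcount l j & 0 <= ind (troot s) j <= tcount s j /\
      0 <= scount sp j /\ 0 <= ind (Some (lead sp x)) j <= scount sp j + ind (Some x) j].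
    have := ind_bounds (Some k) j; have := ind_bounds (Some p) j.
    have := ind_bounds (Some x) j; labels_at l j; labels_at s j.
    by slabels_at sp x j; split; lia.
  set I := fun i => ind (troot s) i + ind (Some (lead sp x)) i.
  have same j : ind (Some k) j = 0 -> ind (troot s) j = 0 -> ind (Some (lead sp x)) j = 0 ->
    cmut k I c j = c j.
    by move=> ? i1 i2; apply: cmut_same => //; rewrite /I; lia.
  split.
  + have := Uj p; have [] := all p; rewrite ind_id => *.
    rewrite same ?cp; lia.
  + have -> : Z.min (X c1) 1 + Z.max (X b) 1 - 1 = X c1 - c k by rewrite ck; lia.
    apply: tvec_root cs => [j|j ?]; have := Uj j; have [] := all j => *; first lia.
    rewrite cmut_neq ?/I; last lia.
    have -> : ind (Some (lead sp x)) j = 0 by lia.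
    lia.
  + split.
    * rewrite cmut_id ck; lia.
    * have -> : Z.min (X d) 1 + Z.max (X c1) 1 - 1 = X c1 by lia.
      by apply: tvec_ext cl => j ?; have := Uj j; have [] := all j => *; apply: same; lia.
    * have -> : Z.max (X c1) 1 = Z.max (X b) 1 + c k by rewrite ck; lia.
      apply: svec_lead csp => [j|j ?]; have := Uj j; have [] := all j => *; first lia.
      rewrite cmut_neq ?/I; last lia.
      have -> : ind (troot s) j = 0 by lia.
      lia.
- have Uj j := U j; move: Uj => /= Uj [ce ct cs].
  have same j : scount sp j + ind (Some x) j = 0 ->
      cmut k (fun i => ind I1 i + ind I2 i) c j = c j.
    move=> t0; have := smove_labels mv j.
    have := ind_bounds (Some k) j; have := ind_bounds I1 j; have := ind_bounds I2 j.
    by have := ind_bounds O1 j; have := ind_bounds O2 j => *; apply: cmut_same; lia.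
  split.
  + rewrite same //; have := Uj e.1; rewrite ind_id.
    have := tcount_ge0 e.2 e.1; have := scount_ge0 sp e.1.
    by have := ind_bounds (Some x) e.1; lia.
  + apply: tvec_ext ct => j ?; apply: same; have := Uj j; have := scount_ge0 sp j.
    by have := ind_bounds (Some x) j; have := ind_bounds (Some e.1) j; lia.
  + apply: IH => // j; have := Uj j; have := tcount_ge0 e.2 j.
    by have := ind_bounds (Some e.1) j; lia.
Qed.

(** * Triangulations of the annulus *)

Record heights (N : Z) (X : Z -> Z) : Prop := Heights {
  heights_mono : forall a b, a <= b -> X a <= X b;
  heights_shift : forall b, X (b + N) = X b + 1;
  heights_le0 : forall b, b <= 0 -> X b <= 0;
  heights_ge0 : forall b, 1 <= b -> 0 <= X b }.

Section Heights.

Context (N : Z) (X : Z -> Z) (HX : heights N X).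

Lemma heights_le1 b : b <= N -> X b <= 1.
Proof.
move=> bN; have := @heights_le0 _ _ HX (b - N); have := heights_shift HX (b - N).
by rewrite Z.sub_add; lia.
Qed.

Lemma heights_ge1 b : N + 1 <= b -> 1 <= X b.
Proof.
move=> bN; have := @heights_ge0 _ _ HX (b - N); have := heights_shift HX (b - N).
by rewrite Z.sub_add; lia.
Qed.

Lemma heights_ge2 b : 2 * N + 1 <= b -> 2 <= X b.
Proof.
move=> bN; have := @heights_ge1 (b - N); have := heights_shift HX (b - N).
by rewrite Z.sub_add; lia.
Qed.

End Heights.

(* The arcs to p start at the outer points start = i_0 < i_1 < ... < i_k = i_0 + N.  The
   last one, labelled extra, is not in segments; together with the first one and the
   inner boundary it bounds the triangle around p. *)
Record state := State { start : Z; segments : spine; extra : nat }.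

Definition label_count (st : state) (i : nat) : Z :=
  scount (segments st) i + ind (Some (extra st)) i.

Definition arrows (st : state) (i j : nat) : Z :=
  triangle (Some (lead (segments st) (extra st))) (Some (extra st)) None i j
  + sarrows (segments st) (extra st) i j.

Definition cvec (X : Z -> Z) (c : nat -> Z) (st : state) : Prop :=
  svec X c (1 + Z.min (X (start st)) 0) (start st) (segments st) (last_vec X c (extra st)).

(** In [step_forward] the arc [k] at i_0 becomes the arc at i_1 + N, the new [extra]; the old
    [extra] at i_0 + N now heads the translate of [t] by N. *)
Inductive step (N : Z) (k : nat) :
  option nat -> option nat -> option nat -> option nat -> state -> state -> Prop :=
| step_spine i sp sp' x O1 I1 O2 I2 :
    smove N x k O1 I1 O2 I2 i sp sp' -> step N k O1 I1 O2 I2 (State i sp x) (State i sp' x)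
| step_forward i t sp x :
    i <= N -> 1 <= i + tnodes t + 1 ->
    step N k (Some x) None (Some (lead sp x)) (troot t)
      (State i ((k, t) :: sp) x) (State (i + tnodes t + 1) (rcons sp (x, t)) k)
| step_backward i t sp y :
    i <= 0 \/ 2 * N + 1 <= i + snodes sp ->
    step N k None (Some (lead sp y)) (troot t) (Some y)
      (State i (rcons sp (y, t)) k) (State (i + snodes sp - N) ((k, t) :: sp) y).

Section Step.

Context (N : Z) (k : nat) (O1 I1 O2 I2 : option nat) (st st' : state).
Context (mv : step N k O1 I1 O2 I2 st st').

Lemma step_size : snodes (segments st') = snodes (segments st).
Proof.
case: mv => /= [? ? ? ? ? ? ? ? /smove_size //| i t sp x _ _|i t sp y _];
  rewrite -cats1 snodes_cat /=; lia.
Qed.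

Lemma step_label_count i : label_count st' i = label_count st i.
Proof.
case: mv => /= [? ? ? ? ? ? ? ? /smove_count H|? t sp x _ _|? t sp y _]; rewrite /label_count /=.
- by rewrite H.
- rewrite -cats1 scount_cat /=; lia.
- rewrite -cats1 scount_cat /=; lia.
Qed.

Context (U : forall i, label_count st i <= 1).

(** Lets arrow multiplicities at [k] be recovered from the signed adjacency. The two arcs on one
    side may coincide: when the spine has a single segment, a rotation flips an arc with a double
    arrow. *)
Lemma step_disjoint i :
  (ind I1 i + ind I2 i = 0) \/ (ind O1 i + ind O2 i = 0).
Proof.
have := U i; case: mv => /= [? ? ? ? o1 i1 o2 i2 /smove_labels H|? t sp x _ _|? t sp y _];
  rewrite /label_count /=.
- have := H i; move: (ind_bounds o1 i) (ind_bounds o2 i) (ind_bounds i1 i) (ind_bounds i2 i).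
  by have := ind_bounds (Some k) i; lia.
- have := ind_bounds (Some k) i; have := ind_bounds (Some x) i.
  by labels_at t i; slabels_at sp x i; rewrite ind_None; lia.
- rewrite -cats1 scount_cat /=.
  have := ind_bounds (Some k) i; have := ind_bounds (Some y) i.
  by labels_at t i; slabels_at sp y i; rewrite ind_None; lia.
Qed.

Lemma lead_rcons_pair sp x (t : tree) y : lead (rcons sp (x, t)) y = lead sp x.
Proof. by case: sp. Qed.

Lemma step_exchange :
  exchange k (fun i => ind I1 i + ind I2 i) (fun i => ind O1 i + ind O2 i)
    (arrows st) (arrows st').
Proof.
have Uk := U k; case: mv Uk U => [i sp sp' x o1 i1 o2 i2 H|? t sp x _ _|? t sp y _] Uk V;
  rewrite /label_count /= in Uk V.
- have := smove_nonlead H; slabels_at sp x k; have := ind_bounds (Some x) k => *.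
  apply: (@exchange_add _ _ _ (sarrows sp x) (sarrows sp' x)
    (triangle (Some (lead sp x)) (Some x) None)).
  + exact: (smove_exchange H).
  + by move=> ?; rewrite triangle_absent //; lia.
  + by move=> *; rewrite triangle_anti.
  + by move=> *; rewrite /arrows /=; lia.
  + by move=> *; rewrite /arrows /= (smove_lead H); lia.
- move: Uk; rewrite ind_id; have := ind_bounds (Some x) k.
  labels_at t k; slabels_at sp x k => *.
  apply: (@exchange_add _ _ _
    (fun i j => triangle (Some k) (Some x) None i j
              + triangle (Some k) (Some (lead sp x)) (troot t) i j)
    (fun i j => triangle (Some k) None (Some (lead sp x)) i j
              + triangle (Some k) (troot t) (Some x) i j)
    (fun i j => tarrows t i j + sarrows sp x i j)).
  + by apply: exchange_triangles => //; rewrite //; lia.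
  + by move=> i; rewrite !tarrows_absent ?sarrows_absent //; lia.
  + by move=> i j; rewrite !(tarrows_anti _ i j) (sarrows_anti _ _ i j); lia.
  + by move=> i j; rewrite /arrows /= /triangle; ring.
  + by move=> i j; rewrite /arrows /= sarrows_rcons lead_rcons_pair /triangle; ring.
- rewrite -cats1 scount_cat /= ind_id in Uk; have := ind_bounds (Some y) k.
  labels_at t k; slabels_at sp y k => *.
  apply: (@exchange_add _ _ _
    (fun i j => triangle (Some k) None (Some (lead sp y)) i j
              + triangle (Some k) (troot t) (Some y) i j)
    (fun i j => triangle (Some k) (Some (lead sp y)) (troot t) i j
              + triangle (Some k) (Some y) None i j)
    (fun i j => tarrows t i j + sarrows sp y i j)).
  + by apply: exchange_triangles => //; rewrite //; lia.
  + by move=> i; rewrite !tarrows_absent ?sarrows_absent //; lia.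
  + by move=> i j; rewrite !(tarrows_anti _ i j) (sarrows_anti _ _ i j); lia.
  + by move=> i j; rewrite /arrows /= sarrows_rcons lead_rcons_pair /triangle; ring.
  + by move=> i j; rewrite /arrows /= /triangle; ring.
Qed.

Context (X : Z -> Z) (HX : heights N X) (sizeN : snodes (segments st) = N).

Lemma step_cvec c :
  cvec X c st -> cvec X (cmut k (fun i => ind I1 i + ind I2 i) c) st'.
Proof.
have Xm := heights_mono HX; have XN := heights_shift HX.
case: mv U sizeN => [i sp sp' x o1 i1 o2 i2 H|i t sp x iN i1|i t sp y Hi] Uj size;
  rewrite /label_count /= in Uj size; rewrite [cvec X c _]/cvec [cvec X _ _]/cvec [start _]/=
    [segments _]/= [extra _]/=.
- have Xle := heights_le1 HX; have Xge := heights_ge1 HX.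
  exact: (smove_vec X c (1 + Z.min (X i) 0) Xle Xge Xm H Uj).
- set d := i + tnodes t + 1 in i1 *; move=> [/= ck ct cs]; rewrite -/d in ck ct.
  have Xi := heights_le1 HX iN; have Xd := heights_ge0 HX i1.
  have Xid : X i <= X d by apply: Xm; have := tnodes_ge0 t; lia.
  have bd j : [/\ 0 <= ind (Some k) j, 0 <= ind (Some x) j,
       0 <= ind (troot t) j <= tcount t j & 0 <= scount sp j].
    have := ind_bounds (Some k) j; have := ind_bounds (Some x) j; labels_at t j.
    by have := scount_ge0 sp j; split; lia.
  have same j : ind (Some k) j = 0 -> ind (troot t) j = 0 ->
      cmut k (fun i => ind None i + ind (troot t) i) c j = c j.
    by move=> ? t0; apply: cmut_same => //; rewrite t0 ind_None.
  apply/svec_rcons; move/svec_end: cs.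
  have -> : d + snodes sp = i + N by rewrite /d; lia.
  (* Both sides equal 1, because i <= N and d >= 1. *)
  have -> : Z.max (X i) 1 = 1 + Z.min (X d) 0 by lia.
  apply: svec_ext => [j ?|h b [-> lx]] /=.
    by have := Uj j; have [] := bd j => *; apply: same; lia.
  move: lx; rewrite /last_vec XN.
  have -> : i + N + tnodes t + 1 = d + N by rewrite /d; lia.
  rewrite XN => cx; split.
  + have := Uj x; have [] := bd x; rewrite ind_id => *.
    by rewrite same ?cx; lia.
  + have := tvec_shift XN ct => ct'.
    have -> : Z.min (X d + 1) 1 + Z.max (X i + 1) 1 - 1
      = Z.min (X d) 1 + Z.max (X i) 1 - 1 + 1 - c k by rewrite ck; lia.
    apply: tvec_root ct' => [j|j ?]; have := Uj j; have [] := bd j => *; first lia.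
    rewrite cmut_neq ?ind_None; lia.
  + rewrite cmut_id ck; lia.
- move: size; rewrite -cats1 snodes_cat /= => size.
  have {}Uj j : scount sp j + ind (Some y) j + tcount t j + ind (Some k) j <= 1.
    by have := Uj j; rewrite -cats1 scount_cat /=; lia.
  move/svec_cat/svec_end; set a := i + snodes sp in Hi *.
  have -> : a - N + tnodes t + 1 = i by rewrite /a; lia.
  have Ea : X a = X (a - N) + 1 by rewrite -XN Z.sub_add.
  have ia : X i <= X a by apply: Xm; rewrite /a; have := snodes_ge0 sp; lia.
  have ai : X a <= X i + 1 by rewrite -XN; apply: Xm; rewrite /a; have := tnodes_ge0 t; lia.
  have Eb : X (a + tnodes t + 1) = X i + 1.
    by rewrite -XN; congr (X _); rewrite /a; lia.
  have cases : (X i <= 0) \/ (2 <= X a).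
    by case: Hi => [/(heights_le0 HX)|/(heights_ge2 HX)]; [left|right].
  have cases' : (X i <= 0) \/ (1 <= X i) by lia.
  clear Hi; rewrite /last_vec /= => cs.
  have [ck ct] : c k = Z.max (X a) 1 - Z.min (X i + 1) 2 /\
     tvec X c a (Z.min (X i + 1) 1 + Z.max (X a) 1 - 1) t.
    by have [h] := svec_last cs; move=> [_ [_ ct ck]] _; rewrite -/a Eb in ct ck.
  have bd j : [/\ 0 <= ind (Some k) j, 0 <= ind (Some y) j,
       0 <= ind (troot t) j <= tcount t j & 0 <= scount sp j /\
       0 <= ind (Some (lead sp y)) j <= scount sp j + ind (Some y) j].
    have := ind_bounds (Some k) j; have := ind_bounds (Some y) j; labels_at t j.
    by slabels_at sp y j; split; lia.
  (* The value of [k] is added in two passes, first to [y] and then to the leading arc; if [sp] is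
     empty these coincide and the value is added twice. *)
  set c' := cmut _ _ _; pose c1 j := if j == y then c y + c k else c j.
  have c1E j : c1 j = c j + ind (Some y) j * c k.
    rewrite /c1; case: eqP => [->|/eqP ne]; first by rewrite ind_id; lia.
    by rewrite ind_neq 1?eq_sym //; lia.
  have c'E j : ind (Some k) j = 0 -> c' j = c1 j + ind (Some (lead sp y)) j * c k.
    by move=> k0; rewrite /c' cmut_neq // c1E; lia.
  split.
  + rewrite /c' cmut_id ck; lia.
  + have X_N b : X (b + - N) = X b + - 1.
      by have := XN (b + - N); rewrite -Z.add_assoc Z.add_opp_diag_l Z.add_0_r; lia.
    have := tvec_shift X_N ct.
    have -> : Z.min (X i + 1) 1 + Z.max (X a) 1 - 1 + -1
      = Z.min (X i) 1 + Z.max (X (a - N)) 1 - 1 by lia.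
    apply: tvec_ext => j ?; have := Uj j; have [] := bd j => *.
    rewrite c'E ?c1E; last lia.
    have -> : ind (Some y) j = 0 by lia.
    have -> : ind (Some (lead sp y)) j = 0 by lia.
    lia.
  + have -> : Z.max (X (a - N)) 1 = 1 + Z.min (X i) 0 + c k by rewrite ck; lia.
    apply: (@svec_lead _ c1) => [j|j ?|].
    * by have := Uj j; have [] := bd j; lia.
    * by apply: c'E; have := Uj j; have [] := bd j; lia.
    * move: cs; rewrite /last_vec; apply: svec_ext => [j ?|h b [-> [+ _ _]]]; last rewrite Eb => cy.
        rewrite c1E; have := Uj j; have [] := bd j => *.
        have -> : ind (Some y) j = 0 by lia.
        lia.
      rewrite c1E ind_id cy ck; lia.
Qed.

End Step.

(** * Green flips *)

(* The lamination attached to the frozen vertex v has lifts leaving the outer boundary at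
   v + 1/2 + j N; height N v b is the least j whose lift starts to the right of b, i.e. the
   ceiling of (b - v) / N. *)
Definition height (N v b : Z) : Z := (b - v + N - 1) / N.

Lemma height_le N v b m : 0 < N -> height N v b <= m <-> b - v <= N * m.
Proof.
move=> N0; rewrite /height.
have := Z.div_mod (b - v + N - 1) N; have := Z.mod_pos_bound (b - v + N - 1) N N0.
move: (_ / _) (_ mod _) => q r ? H; split=> ?; nia.
Qed.

Lemma height_heights N v : 1 <= N -> 0 <= v <= N -> heights N (height N v).
Proof.
move=> N1 vN; split.
- have N0 : 0 < N by lia.
  move=> a b ab; apply/(height_le _ _ _ N0).
  have /(height_le _ _ _ N0) : height N v b <= height N v b by lia.
  lia.
- move=> b; rewrite /height.
  have -> : b + N - v + N - 1 = b - v + N - 1 + 1 * N by lia.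
  by rewrite Z.div_add; lia.
- move=> b b0; apply/height_le; lia.
- move=> b b1; suff: ~ height N v b <= -1 by lia.
  move/height_le; lia.
Qed.

(* The residue of b modulo N is the place where the height jumps just after b; when
   it is 0, both v = 0 and v = N do. *)
Lemma height_jump_low N b : 1 <= N -> b <= N ->
  exists v, [/\ 0 <= v <= N, height N v b < height N v (b + 1) & height N v b <= 0].
Proof.
move=> N1 bN; have := Z.div_mod b N; have := Z.mod_pos_bound b N.
move: (b / N) (b mod N) => q r rN E.
have {rN} rN : 0 <= r < N by lia.
have {E} E : b = N * q + r by lia.
case: (Z.eq_dec r 0) => r0.
(* Not v = 0, whose height at b = N is already 1. *)
- exists N; have q1 : q <= 1 by nia.
  have H1 : height N N b <= q - 1 by apply/height_le; lia.
  have H2 : ~ height N N (b + 1) <= q - 1 by move/height_le; lia.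
  by split; lia.
- exists r; have q0 : q <= 0 by nia.
  have H1 : height N r b <= q by apply/height_le; lia.
  have H2 : ~ height N r (b + 1) <= q by move/height_le; lia.
  by split; lia.
Qed.

Lemma height_jump_high N b : 1 <= N -> N + 1 <= b ->
  exists v, [/\ 0 <= v <= N, height N v (b - 1) < height N v b & 2 <= height N v b].
Proof.
move=> N1 bN; have := Z.div_mod (b - 1) N; have := Z.mod_pos_bound (b - 1) N.
move: ((b - 1) / N) ((b - 1) mod N) => q r rN E.
have {rN} rN : 0 <= r < N by lia.
have {E} E : b - 1 = N * q + r by lia.
have q1 : 1 <= q by nia.
exists r.
have H1 : height N r (b - 1) <= q by apply/height_le; lia.
have H2 : ~ height N r b <= q by move/height_le; lia.
by split; lia.
Qed.

Lemma height_jump N a b : 1 <= N -> a < b ->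
  exists2 v, 0 <= v <= N & height N v a < height N v b.
Proof.
move=> N1 ab; case: (Z.le_gt_cases a N) => aN.
- have [v [v0 vj _]] := height_jump_low N1 aN; exists v => //.
  have [mono _ _ _] := height_heights N1 v0.
  have := mono (a + 1) b; lia.
- have [|v [v0 vj _]] := @height_jump_high N (a + 1) N1; first lia.
  exists v => //; have [mono _ _ _] := height_heights N1 v0.
  by rewrite Z.add_simpl_r in vj; have := mono (a + 1) b; lia.
Qed.

Lemma rotation_green X c k O1 I1 O2 I2 t t' :
  (forall a b, a <= b -> X a <= X b) -> rotation k O1 I1 O2 I2 t t' ->
  forall a e, tvec X c a e t -> 0 <= c k.
Proof.
move=> Xm; elim=> {t t' O1 I1 O2 I2} [p s l r|q l l' r ? ? ? ? _ IH|q l r r' ? ? ? ? _ IH] a e /=.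
- move=> [_ _ [-> _ _]].
  have := Xm (a + tnodes s + 1) (a + tnodes s + 1 + tnodes l + 1); have := tnodes_ge0 l; lia.
- by case=> _ /IH.
- by case=> _ _ /IH.
Qed.

Lemma smove_green X N x c k O1 I1 O2 I2 b sp sp' :
  heights N X -> smove N x k O1 I1 O2 I2 b sp sp' ->
  forall h P, svec X c h b sp P -> 0 <= c k.
Proof.
move=> HX; have Xm := heights_mono HX; have Xle := heights_le1 HX; have Xge := heights_ge1 HX.
elim=> {b sp sp' O1 I1 O2 I2}
  [b p t t' sp ? ? ? ? rt|b p s l sp H|b p s l sp H|b e sp sp' ? ? ? ? _ IH] h P /=.
- by case=> _ /(rotation_green X c Xm rt).
- move=> [_ _ [-> _ _]]; set c1 := b + tnodes s + 1 in H *.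
  have := Xm c1 (c1 + tnodes l + 1); have := Xle _ H; have := Xm b c1.
  have := tnodes_ge0 l; have := tnodes_ge0 s; lia.
- move=> [_ [-> _ _] _]; set c1 := b + tnodes s + 1 in H *.
  have := Xge _ H; have := Xm b c1; have := tnodes_ge0 s; lia.
- by case=> _ _ /IH.
Qed.

(** The numerical condition on each flip is what makes the c-vector of the flipped arc
    nonnegative. *)
Lemma step_green X N c k O1 I1 O2 I2 st st' :
  heights N X -> step N k O1 I1 O2 I2 st st' -> snodes (segments st) = N ->
  cvec X c st -> 0 <= c k.
Proof.
move=> HX; have Xm := heights_mono HX; have Xle := heights_le1 HX; have XN := heights_shift HX.
case=> [i sp sp' x ? ? ? ? H|i t sp x iN i1|i t sp y Hi]; rewrite /cvec /= => size.
- exact: (smove_green c HX H).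
- move=> [-> _ _]; have := Xle _ iN; have := heights_ge0 HX i1.
  have := Xm i (i + tnodes t + 1); have := tnodes_ge0 t; lia.
- move/svec_rcons/svec_last => [h /= [_ _ ->] _].
  move: size; rewrite -cats1 snodes_cat /= => size.
  have -> : i + snodes sp + tnodes t + 1 = i + N by lia.
  rewrite XN; case: Hi => [/(heights_le0 HX)|/(heights_ge2 HX)]; lia.
Qed.

(** * Arcs without an admissible flip are red *)

Definition movable (N : Z) (k : nat) (st : state) : Prop :=
  exists O1 I1 O2 I2 st', step N k O1 I1 O2 I2 st st'.

(** A right child can be rotated. A left child has value X b - X u with b < u, which is negative as
    soon as the height jumps between b and u. *)
Lemma rotation_or_left k t : 0 < tcount t k ->
  [\/ troot t = Some k,
      exists O1 I1 O2 I2 t', rotation k O1 I1 O2 I2 t t' |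
      forall a, exists b u, b < u /\ forall X c e, tvec X c a e t -> c k = X b - X u].
Proof.
elim: t => [|p l IHl r IHr] //= H.
have [->|pk] := eqVneq p k; first by constructor 1.
rewrite ind_neq // in H; have pl := tcount_ge0 l k; have pr := tcount_ge0 r k.
case: (Z.eq_dec (tcount l k) 0) => l0; last first.
- have {}/IHl[] : 0 < tcount l k by lia.
  + case: l {H pl} l0 => [//|q ll lr] _ /= [->]; constructor 3 => a.
    exists (a + tnodes ll + 1), (a + (tnodes ll + tnodes lr + 1) + 1).
    by split; [have := tnodes_ge0 lr; lia|move=> X c e [_ []]].
  + move=> [O1 [I1 [O2 [I2 [l' rt]]]]]; constructor 2.
    by exists O1, I1, O2, I2, (Node p l' r); constructor.
  + move=> H3; constructor 3 => a; have [b [u [bu Hbu]]] := H3 a.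
    by exists b, u; split=> // X c e [_ /Hbu].
- have {}/IHr[] : 0 < tcount r k by lia.
  + case: r {H pr} => [//|q rl rr] /= [->]; constructor 2.
    by do 5 eexists; constructor.
  + move=> [O1 [I1 [O2 [I2 [r' rt]]]]]; constructor 2.
    by exists O1, I1, O2, I2, (Node p l r'); constructor.
  + move=> H3; constructor 3 => a; have [b [u [bu Hbu]]] := H3 (a + tnodes l + 1).
    by exists b, u; split=> // X c e [_ _ /Hbu].
Qed.

Lemma smove_or_red N x k b sp (c : Z -> nat -> Z) h P :
  1 <= N -> 0 < scount sp k -> lead sp x != k ->
  (forall v, 0 <= v <= N -> svec (height N v) (c v) (h v) b sp (P v)) ->
  (exists O1 I1 O2 I2 sp', smove N x k O1 I1 O2 I2 b sp sp') \/
  (exists2 v, 0 <= v <= N & c v k < 0).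
Proof.
move=> N1; elim: sp b h => [|[p s] sp IH] b h //= H pk; rewrite ind_neq // in H => cs.
have ps := tcount_ge0 s k; have psp := scount_ge0 sp k.
have mono v : 0 <= v <= N -> forall a b, a <= b -> height N v a <= height N v b.
  by move=> vN; apply: heights_mono (height_heights N1 vN).
case: (Z.eq_dec (tcount s k) 0) => s0; last first.
- have {}/rotation_or_left[] : 0 < tcount s k by lia.
  + case: s {s0 H ps} cs => [//|q s l] cs /= [qk]; subst q.
    case: (Z.le_gt_cases (N + 1) (b + tnodes s + 1)) => m.
      by left; do 5 eexists; apply: sm_open.
    (* The height is at most 0 at the middle vertex and jumps just after it, so it stays below min
       (X d) 1. *)
    right; have [|v [vN jump low]] := @height_jump_low N (b + tnodes s + 1) N1; first lia.
    exists v => //; have [_ /= [-> _ _] _] := cs v vN.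
    have := mono v vN (b + tnodes s + 1 + 1) (b + (tnodes s + tnodes l + 1) + 1).
    have := tnodes_ge0 l; lia.
  + move=> [O1 [I1 [O2 [I2 [t' rt]]]]]; left.
    by exists O1, I1, O2, I2, ((p, t') :: sp); constructor.
  + move=> /(_ b)[b' [u [bu Hbu]]]; right; have [v vN jump] := height_jump N1 bu.
    by exists v => //; have [_ /Hbu -> _] := cs v vN; lia.
- case: sp {psp} IH H cs => [|[q l] sp] /= IH H cs; first lia.
  have [qk|qk] := eqVneq q k.
  + subst q; case: (Z.le_gt_cases (b + tnodes s + 1) N) => m.
      by left; do 5 eexists; apply: sm_close.
    (* The height jumps just before the endpoint and is at least 2 there, hence exceeds max (X b)
       1. *)
    right; have [|v [vN jump high]] := @height_jump_high N (b + tnodes s + 1) N1; first lia.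
    exists v => //; have [_ _ /= [-> _ _]] := cs v vN.
    have := mono v vN b (b + tnodes s + 1 - 1).
    have := tnodes_ge0 s; lia.
  + have [] := IH (b + tnodes s + 1) (fun v => Z.max (height N v b) 1) _ qk.
    * lia.
    * by move=> v /cs[].
    * move=> [O1 [I1 [O2 [I2 [sp' mv]]]]]; left.
      by do 5 eexists; apply: (@sm_cons _ _ _ _ (p, s)) mv.
    * by right.
Qed.

Lemma movable_or_red N k st (c : Z -> nat -> Z) :
  1 <= N -> snodes (segments st) = N -> 0 < label_count st k ->
  (forall v, 0 <= v <= N -> cvec (height N v) (c v) st) ->
  movable N k st \/ (exists2 v, 0 <= v <= N & c v k < 0).
Proof.
move=> N1; case: st => i sp x; rewrite /label_count /= => size H cs.
have [xk|xk] := eqVneq x k.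
- subst x; case/lastP: sp size H cs => [|sp [y t]] size H cs; first by move: size => /=; lia.
  case: (Z.le_gt_cases i 0) => i0.
    by left; do 5 eexists; apply: step_backward; left.
  case: (Z.le_gt_cases (2 * N + 1) (i + snodes sp)) => a2.
    by left; do 5 eexists; apply: step_backward; right.
  (* For this v the height is at most 1 at the last-but-one arc and at least 2 at i + N. *)
  right; exists (Z.min N (i - 1)); first lia.
  have vN : 0 <= Z.min N (i - 1) <= N by lia.
  have := cs _ vN; rewrite /cvec /= => /svec_rcons/svec_last[h /= [_ _ +]] _.
  rewrite /last_vec => ->.
  move: size; rewrite -cats1 snodes_cat /= => size.
  have := tnodes_ge0 t; have := snodes_ge0 sp => ? ?.
  have H1 : height N (Z.min N (i - 1)) (i + snodes sp) <= 1 by apply/height_le; lia.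
  have H2 : ~ height N (Z.min N (i - 1)) (i + snodes sp + tnodes t + 1) <= 1.
    by move/height_le; lia.
  lia.
- rewrite (ind_neq _ _ xk) in H.
  case: sp size H cs => [|[p t] sp] size H cs; first by move: size => /=; lia.
  have [pk|pk] := eqVneq p k; last first.
    have [] := @smove_or_red N x k i ((p, t) :: sp) c
      (fun v => 1 + Z.min (height N v i) 0) (fun v => last_vec (height N v) (c v) x) N1.
    * lia.
    * by [].
    * exact: cs.
    * move=> [O1 [I1 [O2 [I2 [sp' mv]]]]]; left.
      by do 5 eexists; constructor; exact: mv.
    * by right.
  subst p; case: (Z.le_gt_cases i N) => iN; last first.
    (* As i > N, the height for v = 0 is at least 2 at i. *)
    right; exists 0; first lia.
    have [|/= -> _ _] := cs 0; first lia.
    have H2 : ~ height N 0 i <= 1 by move/height_le; lia.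
    lia.
  case: (Z.le_gt_cases 1 (i + tnodes t + 1)) => i1.
    by left; do 5 eexists; apply: step_forward.
  (* As the next endpoint is at most 0, its height for v = N is negative. *)
  right; exists N; first lia.
  have [|/= -> _ _] := cs N; first lia.
  have := tnodes_ge0 t => ?.
  have H1 : height N N (i + tnodes t + 1) <= -1 by apply/height_le; lia.
  have H2 : height N N i <= 0 by apply/height_le; lia.
  lia.
Qed.

(** * The potential *)

(* Write L b for the leftmost vertex of the triangle with middle vertex b, and g b for the
   last vertex before b among i_0 and the vertices > N joined to p.  The potential sums
   L b - g b over all b, plus 1 for each b that is not a vertex > N joined to p, plus a
   term depending on i_0 only.  In tpot, o is the difference between the first vertex of
   the tree and g. *)
Fixpoint tpot (o : Z) (t : tree) : Z :=
  if t is Node _ l r then o + 1 + tpot o l + tpot (o + tnodes l + 1) r else 0.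

Fixpoint spot (N g b : Z) (sp : spine) : Z :=
  if sp is e :: sp' then
    let d := b + tnodes e.2 + 1 in
    tpot (b - g) e.2
    + (if d <=? N then b - g + 1 + spot N g d sp' else b - g + spot N d d sp')
  else 0.

Definition potential (N : Z) (st : state) : Z :=
  let i := start st in
  (if i <=? 0 then i + N else if i <=? N then i else i - N - 1)
  + spot N i i (segments st).

Lemma tpot_ge0 o t : 0 <= o -> 0 <= tpot o t.
Proof.
elim: t o => [|k l IHl r IHr] o o0 /=; first lia.
have := IHl o o0; have := IHr (o + tnodes l + 1); have := tnodes_ge0 l; lia.
Qed.

Lemma tpot_shift o d t : tpot (o + d) t = tpot o t + d * tnodes t.
Proof.
elim: t o => [|k l IHl r IHr] o /=; first lia.
have -> : o + d + tnodes l + 1 = o + tnodes l + 1 + d by lia.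
rewrite IHl IHr; ring.
Qed.

(** The middle vertex below [k] moves below [p] and inherits the leftmost vertex there; its L drops
    by [tnodes s + 1] and no other L changes. *)
Lemma rotation_tpot k O1 I1 O2 I2 t t' :
  rotation k O1 I1 O2 I2 t t' -> forall o, tpot o t' + 1 <= tpot o t.
Proof.
elim=> {t t' O1 I1 O2 I2} [p s l r|q l l' r ? ? ? ? rt IH|q l r r' ? ? ? ? rt IH] o /=.
- have -> : o + (tnodes s + tnodes l + 1) + 1 = o + tnodes s + 1 + tnodes l + 1 by lia.
  have := tnodes_ge0 s; lia.
- by have := IH o; rewrite (rotation_size rt); lia.
- by have := IH (o + tnodes l + 1); lia.
Qed.

Lemma spot_ge0 N g b sp : g <= b -> 0 <= spot N g b sp.
Proof.
elim: sp g b => [|e sp IH] g b gb /=; first lia.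
have := @tpot_ge0 (b - g) e.2; have := tnodes_ge0 e.2.
case: Z.leb_spec => ?.
- have := IH g (b + tnodes e.2 + 1); lia.
- have := IH (b + tnodes e.2 + 1) (b + tnodes e.2 + 1); lia.
Qed.

(** A removal at c1 <= N lowers L at the next endpoint. A creation at c1 > N raises it, but c1 also
    becomes the value of g up to that endpoint, and c1 loses its extra 1. *)
Lemma smove_spot N x k O1 I1 O2 I2 b sp sp' :
  smove N x k O1 I1 O2 I2 b sp sp' ->
  forall g, g <= b -> spot N g b sp' + 1 <= spot N g b sp.
Proof.
elim=> {b sp sp' O1 I1 O2 I2}
  [b p t t' sp ? ? ? ? rt|b p s l sp H|b p s l sp H|b e sp sp' ? ? ? ? _ IH] g gb /=.
- by have := rotation_tpot rt (b - g); rewrite (rotation_size rt); lia.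
- have -> : b + (tnodes s + tnodes l + 1) + 1 = b + tnodes s + 1 + tnodes l + 1 by lia.
  have -> : b - g + tnodes s + 1 = b + tnodes s + 1 - g by lia.
  case: (Z.leb_spec (b + tnodes s + 1) N) => ?; last lia.
  by have := tnodes_ge0 s; case: Z.leb_spec => ?; lia.
- have -> : b + (tnodes s + tnodes l + 1) + 1 = b + tnodes s + 1 + tnodes l + 1 by lia.
  case: (Z.leb_spec (b + tnodes s + 1) N) => ?; first lia.
  case: Z.leb_spec => ?; first by have := tnodes_ge0 l; lia.
  have -> : b - g + tnodes s + 1 
    = b + tnodes s + 1 - (b + tnodes s + 1) + (b - g + tnodes s + 1) by lia.
  rewrite tpot_shift; have := tnodes_ge0 l; have := tnodes_ge0 s; nia.
- have := tnodes_ge0 e.2; case: Z.leb_spec => ? ?.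
  + by have := IH g; lia.
  + by have := IH (b + tnodes e.2 + 1); lia.
Qed.

Lemma spot_rcons_small N g b sp e : b + snodes sp + tnodes e.2 + 1 <= N ->
  spot N g b (rcons sp e) = spot N g b sp + tpot (b + snodes sp - g) e.2
    + (b + snodes sp - g + 1).
Proof.
elim: sp b => [|f sp IH] b /= H.
  by rewrite Z.add_0_r in H *; case: Z.leb_spec; lia.
have -> : b + (tnodes f.2 + 1 + snodes sp) = b + tnodes f.2 + 1 + snodes sp by lia.
have := tnodes_ge0 e.2; have := snodes_ge0 sp; case: Z.leb_spec => ? ? ?; last lia.
by rewrite IH; lia.
Qed.

Lemma spot_rcons_crossing N g b sp e :
  b + snodes sp <= N -> N < b + snodes sp + tnodes e.2 + 1 ->
  spot N g b (rcons sp e) = spot N g b sp + tpot (b + snodes sp - g) e.2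
    + (b + snodes sp - g).
Proof.
elim: sp b => [|f sp IH] b /= H H'.
  by rewrite !Z.add_0_r in H H' *; case: Z.leb_spec; lia.
have -> : b + (tnodes f.2 + 1 + snodes sp) = b + tnodes f.2 + 1 + snodes sp by lia.
have := tnodes_ge0 e.2; have := snodes_ge0 sp; case: Z.leb_spec => ? ? ?; last lia.
by rewrite IH; lia.
Qed.

Lemma spot_rcons_large N g b sp e :
  N + 1 <= b + snodes sp -> sp <> [::] \/ g = b ->
  spot N g b (rcons sp e) = spot N g b sp + tpot 0 e.2.
Proof.
elim: sp g b => [|f sp IH] g b /= H E.
  have {E} -> : g = b by case: E.
  have := tnodes_ge0 e.2; have -> : b - b = 0 by lia.
  by case: Z.leb_spec; lia.
case: Z.leb_spec => ?; last by rewrite IH; [lia|lia|right].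
by rewrite IH; [lia|lia|left=> sp0; move: H; rewrite sp0 /=; lia].
Qed.

Lemma spot_shift N g d b sp : b + snodes sp <= N ->
  spot N (g - d) b sp = spot N g b sp + d * snodes sp.
Proof.
elim: sp b => [|e sp IH] b /= H; first lia.
have -> : b - (g - d) = b - g + d by lia.
rewrite tpot_shift; have := snodes_ge0 sp; case: Z.leb_spec => ? ?; last lia.
by rewrite IH; lia.
Qed.

Lemma spot_lower N g g' b sp : g <= g' -> g' <= b -> sp <> [::] ->
  spot N g' b sp + (g' - g) <= spot N g b sp.
Proof.
move=> gg; elim: sp b => [|e sp IH] b // gb _ /=.
have -> : b - g = b - g' + (g' - g) by lia.
rewrite tpot_shift; have := tnodes_ge0 e.2 => ?.
have ? : 0 <= (g' - g) * tnodes e.2 by apply: Z.mul_nonneg_nonneg; lia.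
case: Z.leb_spec => ?; last lia.
case: sp IH => [|f sp] IH; first by rewrite /=; lia.
have gd : g' <= b + tnodes e.2 + 1 by lia.
by have := IH _ gd ltac:(by []); lia.
Qed.

(** A rotation moves one segment to the other end of the spine and changes g. The cases are the
    positions of the old and new i_0 relative to 0 and N. *)
Lemma step_potential N k O1 I1 O2 I2 st st' :
  snodes (segments st) = N -> step N k O1 I1 O2 I2 st st' ->
  potential N st' + 1 <= potential N st.
Proof.
move=> + mv; case: mv => [i sp sp' x ? ? ? ? /smove_spot H|i t sp x iN i1|i t sp y Hi];
  rewrite /potential [start _]/= [segments _]/= [start _]/= [segments _]/= => size.
- by have := H i; lia.
- move: size => /=; set d := i + tnodes t + 1 in i1 *.
  have := tnodes_ge0 t; have := snodes_ge0 sp => ? ? size.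
  have {iN} iN : i <=? N by apply/Z.leb_spec0.
  rewrite iN; have -> : i - i = 0 by lia.
  have -> : d <=? 0 = false by apply/Z.leb_gt; lia.
  case: (Z.leb_spec i 0) => i0.
  + have dN : d <=? N by apply/Z.leb_spec0; rewrite /d; lia.
    rewrite dN spot_rcons_crossing /=; [|rewrite /d; lia..].
    have := @spot_shift N d (d - i) d sp.
    have -> : d - (d - i) = i by lia.
    have := tpot_shift 0 (d + snodes sp - d) t.
    have -> : 0 + (d + snodes sp - d) = d + snodes sp - d by lia.
    move=> -> ->; last by rewrite /d; lia.
    have -> : (d - i) * snodes sp = snodes sp * tnodes t + snodes sp by rewrite /d; ring.
    have -> : (d + snodes sp - d) * tnodes t = snodes sp * tnodes t by ring.
    rewrite /d; lia.
  + case: (Z.leb_spec d N) => dN.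
    * have sp0 : sp <> [::] by move=> sp0; move: size; rewrite sp0 /= /d in dN *; lia.
      rewrite spot_rcons_large /=; [|rewrite /d; lia|by left].
      have id : i <= d by rewrite /d; lia.
      have := spot_lower N id (Z.le_refl d) sp0; rewrite /d; lia.
    * rewrite spot_rcons_large /=; [|lia|by right].
      rewrite /d; lia.
- have := tnodes_ge0 t; have := snodes_ge0 sp => ? ?.
  move: size; rewrite -cats1 snodes_cat /= cats1 => size; set a := i + snodes sp in Hi *.
  have -> : a - N + tnodes t + 1 = i by rewrite /a; lia.
  have -> : a - N - (a - N) = 0 by lia.
  case: Hi => Hi.
  + have -> : i <=? 0 by apply/Z.leb_spec0.
    have -> : a - N <=? 0 by apply/Z.leb_spec0; rewrite /a; lia.
    have -> : i <=? N by apply/Z.leb_spec0; lia.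
    rewrite spot_rcons_small /=; last by rewrite /a; lia.
    have := @spot_shift N i (i - (a - N)) i sp.
    have -> : i - (i - (a - N)) = a - N by lia.
    move=> ->; last by rewrite /a; lia.
    have := tpot_shift 0 (i + snodes sp - i) t.
    have -> : 0 + (i + snodes sp - i) = i + snodes sp - i by lia.
    move=> ->.
    have -> : (i + snodes sp - i) * tnodes t = (N - 1 - snodes sp) * snodes sp.
      have -> : tnodes t = N - 1 - snodes sp by lia.
      ring.
    have -> : (i - (a - N)) * snodes sp = (N - 1 - snodes sp) * snodes sp + snodes sp.
      by rewrite /a; ring.
    rewrite /a; lia.
  + have i0 : N + 1 <= i by rewrite /a in Hi; lia.
    have -> : i <=? 0 = false by apply/Z.leb_gt; lia.
    have -> : i <=? N = false by apply/Z.leb_gt; lia.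
    have -> : a - N <=? 0 = false by apply/Z.leb_gt; lia.
    have -> : a - N <=? N = false by apply/Z.leb_gt; lia.
    rewrite spot_rcons_large /=; [|lia|by right].
    rewrite /a; lia.
Qed.

Lemma potential_ge0 N st : 0 <= N -> 0 <= start st -> 0 <= potential N st.
Proof.
move=> N0 i0; rewrite /potential; have := @spot_ge0 N (start st) (start st) (segments st).
by case: Z.leb_spec => ?; [|case: Z.leb_spec => ?]; lia.
Qed.

(** * Quivers tracked by triangulations *)

Lemma step_label N k O1 I1 O2 I2 st st' :
  step N k O1 I1 O2 I2 st st' -> 0 < label_count st k.
Proof.
case=> [i sp sp' x ? ? ? ? H|i t sp x _ _|i t sp y _]; rewrite /label_count /=.
- have := smove_nonlead H; have := ind_bounds (Some (lead sp x)) k.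
  have := ind_bounds (Some x) k; lia.
- rewrite ind_id; have := tcount_ge0 t k; have := scount_ge0 sp k.
  have := ind_bounds (Some x) k; lia.
- rewrite ind_id; have := scount_ge0 (rcons sp (y, t)) k; lia.
Qed.

Lemma cvec_ext X c c' st :
  (forall j, 0 < label_count st j -> c' j = c j) -> cvec X c st -> cvec X c' st.
Proof. exact: svec_ext_last. Qed.

Definition net (q : quiver) (i j : nat) : Z := Z.of_nat (q i j) - Z.of_nat (q j i).

Definition reduced (q : quiver) : Prop := forall i j, q i j = 0%N \/ q j i = 0%N.

(** The invariant of green mutation. The arcs carry each label 0, ..., n once, and [reduced] lets
    [net] determine the multiplicities. *)
Record tracks (n : nat) (q : quiver) (st : state) : Prop := Tracks {
  tracks_size : snodes (segments st) = Z.of_nat n;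
  tracks_labels : forall i, label_count st i = if (i <= n)%N then 1 else 0;
  tracks_reduced : reduced q;
  tracks_arrows : forall i j, (i <= n)%N -> (j <= n)%N -> net q i j = arrows st i j;
  tracks_cvec : forall v, (v <= n)%N ->
    cvec (height (Z.of_nat n) (Z.of_nat v)) (fun i => net q i (frame n.+1 v)) st }.

Lemma green_net m q k : reduced q ->
  green m q k <-> forall v, (v < m)%N -> 0 <= net q k (frame m v).
Proof.
move=> red; split=> [/forallP gr v vm|gr].
  have /eqP := gr (Ordinal vm); rewrite /net /=; lia.
apply/forallP => -[v vm] /=; have := gr v vm; rewrite /net => H.
case: (red (frame m v) k) => [->//|H0]; apply/eqP; lia.
Qed.

Lemma mutate_reduced m k q : reduced (mutate m k q).
Proof.
move=> i j; rewrite /mutate andbC; case: ifP => _; first by left.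
by case: (leqP (mut_step12 k q i j) (mut_step12 k q j i)) => H; [left|right]; lia.
Qed.

Lemma mutate_net m k q i j : ~~ (frozen m i && frozen m j) -> i != k -> j != k ->
  net (mutate m k q) i j
  = net q i j + Z.of_nat (q i k) * Z.of_nat (q k j) - Z.of_nat (q j k) * Z.of_nat (q k i).
Proof.
move=> fij ik jk; rewrite /net /mutate [frozen m j && _]andbC (negbTE fij) /mut_step12.
rewrite (negbTE ik) (negbTE jk); nia.
Qed.

Lemma mutate_net_pivot m k q j : (k < m)%N -> net (mutate m k q) k j = - net q k j.
Proof.
move=> km; rewrite /net /mutate /frozen [(m <= k)%N]leqNgt km /= andbF /mut_step12 eqxx.
by case: eqP => [->|_]; lia.
Qed.

Lemma net_anti q i j : net q j i = - net q i j.
Proof. rewrite /net; lia. Qed.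

Lemma tracks_step n q k O1 I1 O2 I2 st st' :
  (1 <= n)%N -> tracks n q st -> step (Z.of_nat n) k O1 I1 O2 I2 st st' ->
  tracks n (mutate n.+1 k q) st'.
Proof.
move=> n1 [size labels red arr cv] mv.
have kn : (k <= n)%N.
  by have := step_label mv; rewrite labels; case: leqP => //; lia.
have U i : label_count st i <= 1 by rewrite labels; case: leqP; lia.
have H v : (v <= n)%N -> heights (Z.of_nat n) (height (Z.of_nat n) (Z.of_nat v)).
  by move=> vn; apply: height_heights; lia.
have gr v : (v <= n)%N -> 0 <= net q k (frame n.+1 v).
  by move=> vn; apply: (step_green _ (H v vn) mv size (cv v vn)).
have [[Ik Ok] Hk Ha He] := step_exchange mv U.
have qI i : (i <= n)%N -> Z.of_nat (q i k) = ind I1 i + ind I2 i /\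
    Z.of_nat (q k i) = ind O1 i + ind O2 i.
  move=> iN; have := arr i k iN kn; case: (Hk i) => -> _; rewrite /net.
  have := ind_bounds I1 i; have := ind_bounds I2 i; have := ind_bounds O1 i.
  have := ind_bounds O2 i; case: (red i k); case: (step_disjoint mv U i); lia.
split.
- by rewrite (step_size mv).
- by move=> i; rewrite (step_label_count mv).
- exact: mutate_reduced.
- move=> i j iN jN.
  have [->|ik] := eqVneq i k.
    rewrite mutate_net_pivot // arr //; case: (Hk j) => e1 e2.
    by case: (Ha j k) => -> ->; rewrite e1 e2; lia.
  have [->|jk] := eqVneq j k.
    by rewrite net_anti mutate_net_pivot // net_anti arr //; case: (Hk i) => -> ->; lia.
  rewrite He // mutate_net //; last by rewrite /frozen leqNgt ltnS iN.
  have [-> ->] := qI i iN; have [-> ->] := qI j jN.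
  by rewrite arr //; lia.
- move=> v vn; have := step_cvec mv U (H v vn) size _ (cv v vn); apply: cvec_ext => j.
  rewrite (step_label_count mv) labels; case: (leqP j n) => // jn _.
  have [->|jk] := eqVneq j k; first by rewrite cmut_id mutate_net_pivot.
  rewrite cmut_neq ?ind_neq 1?eq_sym // mutate_net //.
  (* As [k] is green, no arrow from a frozen vertex to [k] contributes. *)
  + have [-> _] := qI j jn; have := gr v vn; rewrite /net.
    have -> : q (frame n.+1 v) k = 0%N; last by lia.
    have := gr v vn; rewrite /net; case: (red k (frame n.+1 v)); lia.
  + by rewrite /frozen leqNgt ltnS jn.
  + by rewrite /frame; apply/eqP; lia.
Qed.

Lemma movable_green n q st k :
  (1 <= n)%N -> tracks n q st -> (k <= n)%N ->
  green n.+1 q k -> movable (Z.of_nat n) k st.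
Proof.
move=> n1 [size labels red _ cv] kn /(green_net _ _ red) gr.
have N1 : 1 <= Z.of_nat n by lia.
have pos : 0 < label_count st k by rewrite labels kn.
pose c v i := net q i (frame n.+1 (Z.to_nat v)).
have cs v : 0 <= v <= Z.of_nat n -> cvec (height (Z.of_nat n) v) (c v) st.
  move=> vN; have := cv (Z.to_nat v); rewrite Z2Nat.id; last lia.
  by apply; lia.
have [//|[v vN]] := @movable_or_red _ _ _ _ N1 size pos cs.
by have := gr (Z.to_nat v); rewrite /c; lia.
Qed.

Lemma green_movable n q st k :
  (1 <= n)%N -> tracks n q st -> movable (Z.of_nat n) k st -> green n.+1 q k.
Proof.
move=> n1 [size labels red _ cv] [O1 [I1 [O2 [I2 [st' mv]]]]].
apply/green_net => // v vn.
have vN : (v <= n)%N by [].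
have Hv : heights (Z.of_nat n) (height (Z.of_nat n) (Z.of_nat v)).
  by apply: height_heights; lia.
exact: (step_green _ Hv mv size (cv v vN)).
Qed.

(** Forces i_0 >= 1 after a maximal green sequence, so that [potential_ge0] applies. If i_0 <= 0,
    the height at i_0 + n is at most 1, while h >= 1. *)
Lemma green_extra n q st : (1 <= n)%N -> tracks n q st -> start st <= 0 ->
  (extra st <= n)%N /\ green n.+1 q (extra st).
Proof.
move=> n1 [size labels red _ cv] i0; split.
  have := labels (extra st); case: leqP => //.
  by rewrite /label_count ind_id; have := scount_ge0 (segments st) (extra st); lia.
apply/green_net => // v vn; have vN : (v <= n)%N by [].
have := cv v vN => /svec_last[h]; rewrite /last_vec size => -> h1.
have Hv : heights (Z.of_nat n) (height (Z.of_nat n) (Z.of_nat v)).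
  by apply: height_heights; lia.
have := @heights_le1 _ _ Hv (start st + Z.of_nat n).
have : 1 <= h by apply: h1 => s0; move: size; rewrite s0 /=; lia.
lia.
Qed.

Lemma green_run n q s st :
  (1 <= n)%N -> tracks n q st -> green_from n.+1 q s ->
  exists2 st', tracks n (mutate_seq n.+1 s q) st' &
    potential (Z.of_nat n) st' + Z.of_nat (size s) <= potential (Z.of_nat n) st.
Proof.
move=> n1; elim: s q st => [|k s IH] q st tr /=.
  by exists st => //; lia.
case/and3P=> kn gr; have [O1 [I1 [O2 [I2 [st1 mv]]]]] := movable_green k n1 tr kn gr.
move=> /(IH _ _ (tracks_step n1 tr mv))[st' tr' le]; exists st' => //.
by have := step_potential (tracks_size tr) mv; lia.
Qed.

(** * The initial triangulation and persistence of green vertices *)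

Definition fan (L : seq nat) : spine := [seq (k, Leaf) | k <- L].

Lemma fan_nodes L : snodes (fan L) = Z.of_nat (size L).
Proof. by elim: L => [|k L IH] //=; rewrite IH; lia. Qed.

Lemma fan_count a m i :
  scount (fan (iota a m)) i = if (a <= i < a + m)%N then 1 else 0.
Proof.
elim: m a => [|m IH] a /=; first by case: ifP => //; lia.
by rewrite IH ind_Some; do ! case: ifP; lia.
Qed.

Lemma fan_arrows a m i j :
  sarrows (fan (iota a m)) (a + m)%N i j
  = (if (a <= i < a + m)%N && (j == i.+1) then 1 else 0)
    - (if (a <= j < a + m)%N && (i == j.+1) then 1 else 0).
Proof.
elim: m a => [|m IH] a /=; first by case: ifP; case: ifP; lia.
have -> : lead (fan (iota a.+1 m)) (a + m.+1) = a.+1.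
  by case: m {IH} => [|m] //=; rewrite addn1.
rewrite -addSnnS IH /triangle !ind_Some !ind_None.
by do ! case: ifP; lia.
Qed.

(** An arithmetic progression, doubled to avoid division. For b = 0 and n segments it sums to
    n(n+1)/2; the term i_0 + N adds n, giving n(n+3)/2. *)
Lemma fan_spot N b L : b + Z.of_nat (size L) <= N ->
  2 * spot N 0 b (fan L) = Z.of_nat (size L) * (2 * b + Z.of_nat (size L) + 1).
Proof.
elim: L b => [|k L IH] b //= H; rewrite Z.sub_0_r.
case: Z.leb_spec => ?; last lia.
have := IH (b + 0 + 1); lia.
Qed.

Lemma fan_cvec n v a m (c : nat -> Z) : (1 <= a)%N -> (a + m)%N = n -> (v <= n)%N ->
  (forall i, (i <= n)%N -> c i = if i == v then 1 else 0) ->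
  svec (height (Z.of_nat n) (Z.of_nat v)) c 1 (Z.of_nat a) (fan (iota a m))
    (last_vec (height (Z.of_nat n) (Z.of_nat v)) c n).
Proof.
move=> + + vn cE; have [->|n1] := posnP n; first lia.
have H : heights (Z.of_nat n) (height (Z.of_nat n) (Z.of_nat v)).
  by apply: height_heights; lia.
have hE b : (1 <= b <= n)%N ->
  height (Z.of_nat n) (Z.of_nat v) (Z.of_nat b) = if (v < b)%N then 1 else 0.
  move=> b1; have := @heights_le1 _ _ H (Z.of_nat b); have := @heights_ge0 _ _ H (Z.of_nat b).
  have := @height_le (Z.of_nat n) (Z.of_nat v) (Z.of_nat b) 0.
  by case: ltnP; lia.
elim: m a => [|m IH] a a1 am /=.
  rewrite /last_vec; move: am; rewrite addn0 => ->; rewrite hE // ?cE //; last lia.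
  by case: ifP; case: ifP; lia.
have -> : Z.of_nat a + 0 + 1 = Z.of_nat a.+1 by lia.
rewrite !hE ?cE; try lia; split => //.
- by do ! case: ifP; lia.
- have -> : Z.max (if (v < a)%N then 1 else 0) 1 = 1 by case: ifP.
  by apply: IH; lia.
Qed.

Lemma tracks_start n : (1 <= n)%N ->
  tracks n (framed n.+1 (quiver_A_tilde_n1 n)) (State 0 (fan (iota 0 n)) n).
Proof.
move=> n1; have ld : lead (fan (iota 0 n)) n = 0%N by case: n n1.
split=> /=.
- by rewrite fan_nodes size_iota.
- move=> i; rewrite /label_count /= fan_count ind_Some.
  by do ! case: ifP; lia.
- by move=> i j; rewrite /framed /quiver_A_tilde_n1 /frame; do ! case: ifP; lia.
- move=> i j iN jN; rewrite /arrows /= ld -{3}[n]add0n fan_arrows /net /framed !ltnS iN jN /=.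
  rewrite /quiver_A_tilde_n1 /triangle !ind_Some !ind_None.
  by do ! case: ifP; lia.
- move=> v vn; set c := fun i => net _ _ _.
  have cE i : (i <= n)%N -> c i = if i == v then 1 else 0.
    move=> iN; rewrite /c /net /framed /frame.
    by do ! case: ifP; lia.
  have iE : iota 0 n = 0%N :: iota 1 n.-1 by case: (n) n1.
  rewrite /cvec /= iE /=.
  have H : heights (Z.of_nat n) (height (Z.of_nat n) (Z.of_nat v)).
    by apply: height_heights; lia.
  split=> //.
  + rewrite cE //; have := heights_le1 H (b := 0 + 0 + 1); have := heights_ge0 H (b := 0 + 0 + 1).
    have := heights_le0 H (b := 0).
    have := @height_le (Z.of_nat n) (Z.of_nat v) (0 + 0 + 1) 0.
    by case: eqP; lia.
  + have -> : Z.max (height (Z.of_nat n) (Z.of_nat v) 0) 1 = 1.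
      by have := heights_le0 H (b := 0); lia.
    by apply: (@fan_cvec n v 1 n.-1) => //; lia.
Qed.

(** A new arrow from a frozen vertex to [k] would need one from it to the mutated vertex, which is
    green. *)
Lemma green_stable m q s k : (k < m)%N -> k \notin s -> reduced q ->
  green_from m q s -> green m q k -> green m (mutate_seq m s q) k.
Proof.
move=> km; elim: s q => [|j s IH] q //=; rewrite inE negb_or => /andP[kj ks] red.
case/and3P=> jm gj gs gk; apply: IH => //; first exact: mutate_reduced.
apply/green_net => [|v vm]; first exact: mutate_reduced.
rewrite mutate_net //; last 2 first.
- by rewrite /frozen leqNgt km.
- by rewrite /frame; apply/eqP; lia.
have /forallP/(_ (Ordinal vm))/eqP /= -> := gj.
by have /(green_net _ _ red)/(_ v vm) := gk; lia.
Qed.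

(** * Paths of prescribed length *)

Inductive steps (T : Type) (R : T -> T -> Prop) : nat -> T -> T -> Prop :=
| steps_nil x : steps R 0 x x
| steps_cons l x y z : R x y -> steps R l y z -> steps R l.+1 x z.

Arguments steps_cons {T R l x y z}.

Lemma steps_one T (R : T -> T -> Prop) x y : R x y -> steps R 1 x y.
Proof. by move=> xy; apply: steps_cons xy (steps_nil _ _). Qed.

Arguments steps_one {T R x y}.

Lemma steps_cat T (R : T -> T -> Prop) l l' x y z :
  steps R l x y -> steps R l' y z -> steps R (l + l') x z.
Proof.
elim=> [//|{x y} k x y w xy _ IH] /IH; rewrite addSn; exact: steps_cons.
Qed.

Arguments steps_cat {T R l l' x y z}.

Lemma steps_map T T' (R : T -> T -> Prop) (R' : T' -> T' -> Prop) (f : T -> T') l x y :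
  (forall x y, R x y -> R' (f x) (f y)) -> steps R l x y -> steps R' l (f x) (f y).
Proof.
move=> RR; elim=> [{}x|{x y} k x y z /RR xy _]; [exact: steps_nil|exact: steps_cons].
Qed.

Arguments steps_map {T T' R R' f l x y}.

Definition rotates (t t' : tree) : Prop :=
  exists k O1 I1 O2 I2, rotation k O1 I1 O2 I2 t t'.

Definition smoves (N : Z) (x : nat) (b : Z) (sp sp' : spine) : Prop :=
  exists k O1 I1 O2 I2, smove N x k O1 I1 O2 I2 b sp sp'.

Definition moves (N : Z) (st st' : state) : Prop :=
  exists k O1 I1 O2 I2, step N k O1 I1 O2 I2 st st'.

Fixpoint left_comb (m : nat) (t : tree) : Prop :=
  match m, t with
  | 0%N, Leaf => True
  | m.+1, Node _ l Leaf => left_comb m l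
  | _, _ => False
  end.

Fixpoint right_comb (m : nat) (t : tree) : Prop :=
  match m, t with
  | 0%N, Leaf => True
  | m.+1, Node _ Leaf r => right_comb m r
  | _, _ => False
  end.

Lemma left_comb_nodes m t : left_comb m t -> tnodes t = Z.of_nat m.
Proof.
elim: m t => [|m IH] [|k l [|? ? ?]] //= /IH ->; lia.
Qed.

(** Each rotation at the top moves the empty left side one level down the comb. *)
Lemma left_comb_extend m p t : left_comb m t ->
  exists2 t', steps rotates m (Node p Leaf t) t' & left_comb m.+1 t'.
Proof.
elim: m p t => [|m IH] p [|k l [|? ? ?]] // H.
  by exists (Node p Leaf Leaf) => //; apply: steps_nil.
have [l' st' cl] := IH k l H; exists (Node p l' Leaf) => //.
apply: (steps_cons (y := Node p (Node k Leaf l) Leaf)).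
  by do 5 eexists; apply: rot_here.
apply: (steps_map (f := fun s => Node p s Leaf)) st' => s s' [k' [? [? [? [? rt]]]]].
by do 5 eexists; apply: rot_left rt.
Qed.

(** Straightening the right subtree first costs 0 + 1 + ... + (m - 1) rotations. *)
Lemma right_to_left_comb m t : right_comb m t ->
  exists2 t', steps rotates 'C(m, 2) t t' & left_comb m t'.
Proof.
elim: m t => [|m IH] [|p [|? ? ?] r] //= H.
  by exists Leaf => //; apply: steps_nil.
have [r' st1 cr] := IH r H; have [t' st2 ct] := left_comb_extend _ p _ cr.
exists t' => //; rewrite binS bin1; apply: steps_cat st2.
apply: (steps_map (f := fun s => Node p Leaf s)) st1 => s s' [k' [? [? [? [? rt]]]]].
by do 5 eexists; apply: rot_right rt.
Qed.

Lemma smoves_cons N x b e sp sp' l :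
  steps (smoves N x (b + tnodes e.2 + 1)) l sp sp' ->
  steps (smoves N x b) l (e :: sp) (e :: sp').
Proof.
apply: (steps_map (f := cons e)) => s s' [k [? [? [? [? mv]]]]].
by do 5 eexists; apply: sm_cons mv.
Qed.

Arguments smoves_cons {N x b e sp sp' l}.

Lemma smoves_fan N x b L sp sp' l :
  steps (smoves N x (b + Z.of_nat (size L))) l sp sp' ->
  steps (smoves N x b) l (fan L ++ sp) (fan L ++ sp').
Proof.
elim: L b => [|k L IH] b /=; first by rewrite Z.add_0_r.
move=> H; apply: smoves_cons; apply: IH => /=.
by have -> : b + 0 + 1 + Z.of_nat (size L) = b + Z.of_nat (size L).+1 by lia.
Qed.

Arguments smoves_fan {N x b L sp sp' l}.

Lemma smoves_tree N x b p t t' sp l :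
  steps rotates l t t' -> steps (smoves N x b) l ((p, t) :: sp) ((p, t') :: sp).
Proof.
apply: (steps_map (f := fun s => (p, s) :: sp)) => s s' [k [? [? [? [? rt]]]]].
by do 5 eexists; apply: sm_rot rt.
Qed.

Arguments smoves_tree {N x b} p {t t'} sp {l}.

(** The arcs are removed from right to left, which builds a right comb. *)
Lemma close_fan N x b p L sp : b + Z.of_nat (size L) <= N ->
  exists2 t, steps (smoves N x b) (size L) (fan (p :: L) ++ sp) ((p, t) :: sp) &
    right_comb (size L) t.
Proof.
elim: L b p => [|k L IH] b p /= H.
  by exists Leaf => //; apply: steps_nil.
have [|t st ct] := IH (b + 0 + 1) k; first lia.
exists (Node k Leaf t) => //; rewrite -addn1; apply: steps_cat.
  exact: (smoves_cons (e := (p, Leaf)) st).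
by apply: steps_one; do 5 eexists; apply: sm_close => /=; lia.
Qed.

(** The root of a left comb has the rightmost middle vertex, so arcs are created from right to
    left. *)
Lemma open_comb N x b p m r t sp : left_comb (m + r) t -> N <= b + Z.of_nat m ->
  exists t' L, [/\ steps (smoves N x b) r ((p, t) :: sp) ((p, t') :: fan L ++ sp),
    left_comb m t' & size L = r].
Proof.
elim: r t sp => [|r IH] t sp.
  by rewrite addn0 => ct _; exists t, [::]; split=> //; apply: steps_nil.
rewrite addnS; case: t => [//|k l [|//]] /= cl bN.
have [t' [L [st ct sL]]] := IH l ((k, Leaf) :: sp) cl bN.
exists t', (rcons L k); split; rewrite ?size_rcons ?sL //.
apply: (steps_cons (y := (p, l) :: (k, Leaf) :: sp)).
  by do 5 eexists; apply: sm_open; rewrite (left_comb_nodes _ _ cl); lia.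
by rewrite /fan map_rcons cat_rcons.
Qed.

Lemma moves_spine N i x sp sp' l : steps (smoves N x i) l sp sp' ->
  steps (moves N) l (State i sp x) (State i sp' x).
Proof.
apply: (steps_map (f := fun s => State i s x)) => s s' [k [? [? [? [? mv]]]]].
by do 5 eexists; apply: step_spine mv.
Qed.

Arguments moves_spine {N i x sp sp' l}.

Lemma forward_fan N i L sp x : 0 <= i -> i + Z.of_nat (size L) <= N + 1 ->
  exists L' x', steps (moves N) (size L) (State i (fan L ++ sp) x)
    (State (i + Z.of_nat (size L)) (sp ++ fan L') x') /\ size L' = size L.
Proof.
elim: L i sp x => [|k L IH] i sp x /= i0 iN.
  by exists [::], x; rewrite Z.add_0_r cats0; split=> //; apply: steps_nil.
have [||L' [x' [st sL]]] := IH (i + 0 + 1) (rcons sp (x, Leaf)) k; [lia..|].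
exists (x :: L'), x'; rewrite /= sL; split=> //.
rewrite cat_rcons in st.
have <- : i + 0 + 1 + Z.of_nat (size L) = i + Z.of_nat (size L).+1 by lia.
apply: steps_cons st; do 5 eexists; rewrite -rcons_cat.
by apply: (@step_forward _ _ i Leaf); rewrite /=; lia.
Qed.

(** In a fan the last-but-one arc starts at i_0 + n - 1, so backward rotations are allowed as long
    as i_0 >= n + 2, and each lowers i_0 by 1. *)
Lemma backward_fan n r L x : size L = n -> (1 <= n)%N ->
  exists L' x', steps (moves (Z.of_nat n)) r
    (State (Z.of_nat n + 1 + Z.of_nat r) (fan L) x)
    (State (Z.of_nat n + 1) (fan L') x') /\ size L' = n.
Proof.
move=> + n1; elim: r L x => [|r IH] L x sL.
  by exists L, x; rewrite Z.add_0_r; split=> //; apply: steps_nil.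
case/lastP: L sL => [|L y]; first by move=> sL; move: n1; rewrite -sL.
rewrite size_rcons => sL.
have [|L' [x' [st sL']]] := IH (x :: L) y; first by [].
exists L', x'; split=> //; apply: steps_cons st; do 5 eexists.
rewrite /fan map_rcons -/(fan _).
have -> : Z.of_nat n + 1 + Z.of_nat r
  = Z.of_nat n + 1 + Z.of_nat r.+1 + snodes (fan L) - Z.of_nat n by rewrite fan_nodes; lia.
by apply: step_backward; right; rewrite fan_nodes; lia.
Qed.

Lemma forward_comb N i p t sp x : i <= N -> 1 <= i + tnodes t + 1 ->
  moves N (State i ((p, t) :: sp) x) (State (i + tnodes t + 1) (rcons sp (x, t)) p).
Proof. by move=> *; do 5 eexists; apply: step_forward. Qed.

(* Starting from the fan at 0: remove m consecutive arcs, rotate the polygon they leave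
   behind, move forward until i_0 = N, create m - r arcs, move forward once, create the
   other r arcs, and move backward r times. *)
Lemma maximal_path n m r : (m < n)%N -> (r <= m)%N ->
  exists L x, steps (moves (Z.of_nat n)) (n.+1 + 'C(m.+1, 2) + r)
    (State 0 (fan (iota 0 n)) n) (State (Z.of_nat n + 1) (fan L) x) /\ size L = n.
Proof.
move=> mn rm; set N := Z.of_nat n.
have -> : iota 0 n = (0%N :: iota 1 m) ++ iota m.+1 (n - m.+1).
  by rewrite -[0%N :: iota 1 m]/(iota 0 m.+1) -iotaD subnKC.
set R := iota m.+1 _; rewrite /fan map_cat -!/(fan _).
have sR : size R = (n - m.+1)%N by rewrite size_iota.
have [|t1 st1 ct1] := @close_fan N n 0 0%N (iota 1 m) (fan R).
  by rewrite size_iota /N; lia.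
rewrite size_iota in st1 ct1.
have [t2 st2 ct2] := right_to_left_comb _ _ ct1.
have nt2 := left_comb_nodes _ _ ct2.
have st3 : moves N (State 0 ((0%N, t2) :: fan R) n)
    (State (0 + tnodes t2 + 1) (rcons (fan R) (n, t2)) 0).
  by apply: forward_comb; lia.
have [||R' [x4 [st4 sR']]] := @forward_fan N (0 + tnodes t2 + 1) R [:: (n, t2)] 0%N.
- lia.
- by rewrite nt2 sR /N; lia.
rewrite cats1 in st4; have E4 : 0 + tnodes t2 + 1 + Z.of_nat (size R) = N.
  by rewrite nt2 sR /N; lia.
rewrite E4 in st4.
have [||t5 [L5 [st5 ct5 sL5]]] := @open_comb N x4 N n r (m - r) t2 (fan R').
- by rewrite subnKC.
- lia.
have nt5 := left_comb_nodes _ _ ct5.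
(* [t5] still has r nodes, so i_0 jumps from N to N + r + 1; this excess is what the r backward
   rotations undo. *)
have st6 : moves N (State N ((n, t5) :: fan L5 ++ fan R') x4)
    (State (N + tnodes t5 + 1) (rcons (fan L5 ++ fan R') (x4, t5)) n).
  by apply: forward_comb; rewrite /N; lia.
rewrite /fan -map_cat -/(fan _) -cats1 in st6.
have [||t7 [L7 [st7 ct7 sL7]]] :=
  @open_comb N n (N + tnodes t5 + 1 + Z.of_nat (size (L5 ++ R'))) x4 0 r t5 [::].
- by [].
- by rewrite nt5 /N; lia.
have t7E : t7 = Leaf by case: t7 ct7 {st7}.
rewrite t7E cats0 in st7; have {st7} := smoves_fan st7.
set L8 := (L5 ++ R') ++ x4 :: L7.
have -> : fan (L5 ++ R') ++ (x4, Leaf) :: fan L7 = fan L8 by rewrite /L8 /fan [in RHS]map_cat.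
move=> st7.
have sL8 : size L8 = n by rewrite /L8 !size_cat /= sL5 sR' sR sL7; lia.
have [|L9 [x9 [st9 sL9]]] := @backward_fan n r L8 n sL8; first lia.
exists L9, x9; split=> //.
(* In order: removals, tree rotations, first forward rotation, those over [R], m - r creations, the
   forward rotation past N, r creations, r backward rotations. *)
have -> : (n.+1 + 'C(m.+1, 2) + r
  = m + ('C(m, 2) + (1 + (size R + ((m - r) + (1 + (r + r)))))))%N.
  by rewrite binS bin1 sR; lia.
apply: steps_cat (moves_spine st1) _; apply: steps_cat (moves_spine (smoves_tree _ _ st2)) _.
apply: steps_cat (steps_one st3) _; apply: steps_cat st4 _.
apply: steps_cat (moves_spine st5) _; apply: steps_cat.
  rewrite /fan -map_cat -/(fan _); exact: steps_one st6.
apply: steps_cat (moves_spine st7) _.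
by have -> : N + tnodes t5 + 1 = N + 1 + Z.of_nat r by lia.
Qed.

Lemma steps_green n l q st st' : (1 <= n)%N -> tracks n q st ->
  steps (moves (Z.of_nat n)) l st st' ->
  exists s, [/\ green_from n.+1 q s, size s = l & tracks n (mutate_seq n.+1 s q) st'].
Proof.
move=> n1 + H; elim: H q => [{}st|{st st'} k st st1 st' mv _ IH] q tr.
  by exists [::].
have [j [O1 [I1 [O2 [I2 sj]]]]] := mv.
have [s [gs sz trs]] := IH _ (tracks_step n1 tr sj).
exists (j :: s); split=> //=; last by rewrite sz.
rewrite gs (green_movable n1 tr); last by exists O1, I1, O2, I2, st1.
by have := step_label sj; rewrite (tracks_labels tr) ltnS; case: leqP => //; lia.
Qed.

(** * Maximality of the paths and the set of lengths *)

Lemma fan_spot_final N b L : N < b -> spot N b b (fan L) = 0.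
Proof.
elim: L b => [|k L IH] b bN //=; rewrite Z.sub_diag.
by case: Z.leb_spec => ?; [|rewrite IH]; lia.
Qed.

Lemma step_start N k O1 I1 O2 I2 st st' :
  0 <= N -> step N k O1 I1 O2 I2 st st' -> 1 <= start st -> 0 <= start st'.
Proof. by move=> N0; case=> /= *; lia. Qed.

(** The potential of this fan is 0, and a further green flip would make it negative at a state with
    i_0 >= 0. *)
Lemma final_not_green n q L x k : (1 <= n)%N ->
  tracks n q (State (Z.of_nat n + 1) (fan L) x) -> (k <= n)%N -> ~~ green n.+1 q k.
Proof.
move=> n1 tr kn; apply/negP => /(movable_green k n1 tr kn)[O1 [I1 [O2 [I2 [st' mv]]]]].
have := step_potential (tracks_size tr) mv.
rewrite {2}/potential [start _]/= [segments _]/= fan_spot_final; last lia.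
have : 0 <= potential (Z.of_nat n) st'.
  apply: potential_ge0; first lia.
  by apply: (step_start _ mv) => /=; lia.
by case: Z.leb_spec => ?; [|case: Z.leb_spec => ?]; lia.
Qed.

Lemma triangular_split t : exists m r, (r <= m)%N /\ t = ('C(m.+1, 2) + r)%N.
Proof.
elim: t => [|t [m [r [rm ->]]]]; first by exists 0%N, 0%N.
have [rm'|] := ltnP r m; first by exists m, r.+1; split=> //; lia.
by exists m.+1, 0%N; split=> //; rewrite [in RHS]binS bin1; lia.
Qed.

Close Scope Z_scope.

Theorem theorem5p3 (n : nat) (hn : 1 <= n) (l : nat) :
  (exists s : seq nat,
      maximal_green_sequence n.+1 (quiver_A_tilde_n1 n) s /\ size s = l)
  <-> n.+1 <= l <= (n * (n + 3)) %/ 2.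
Proof.
have start_tracks := tracks_start _ hn; split.
- case=> s [/andP[gs /forallP ends] <-].
  have [st tr bound] := green_run s hn start_tracks gs.
  apply/andP; split.
  + rewrite leqNgt; apply/negP => short.
    (* Pigeonhole: fewer than n + 1 mutations miss some vertex. *)
    have [k kn ks] : exists2 k, k < n.+1 & k \notin s.
      have /allPn[k] : ~~ all (mem s) (iota 0 n.+1).
        apply/negP => /allP sub; have := uniq_leq_size (iota_uniq 0 n.+1) sub.
        by rewrite size_iota leqNgt short.
      by rewrite mem_iota add0n => /andP[_ kn] ks; exists k.
    have red := tracks_reduced start_tracks.
    have := ends (Ordinal kn); rewrite /= (@green_stable _ _ _ _ kn ks red gs) //.
    apply/forallP => -[v vn] /=; rewrite /framed /frame; apply/eqP.
    by do ! case: ifP; lia.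
  + have st1 : (0 < start st)%Z.
      case: (Z.le_gt_cases (start st) 0) => // i0.
      have [xn gx] := green_extra hn tr i0.
      have xn' : extra st < n.+1 by [].
      by have := ends (Ordinal xn'); rewrite /= gx.
    have := @potential_ge0 (Z.of_nat n) st.
    have := @fan_spot (Z.of_nat n) 0%Z (iota 0 n); rewrite size_iota.
    move: bound; rewrite [potential _ (State _ _ _)]/potential /=.
    rewrite leq_divRL //; nia.
- case/andP=> ln lu; have [m [r [rm E]]] := triangular_split (l - n.+1).
  (* The excess l - (n + 1) is at most n(n+1)/2 - 1, while m >= n would make it at least
     n(n+1)/2. *)
  have mn : m < n.
    rewrite ltnNge; apply/negP => nm.
    have : 'C(n.+1, 2) <= 'C(m.+1, 2) by apply: leq_bin2l.
    have := bin2 n.+1; have := mul_bin_diag n.+1 1; rewrite bin1 /=.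
    move: lu; rewrite leq_divRL //; nia.
  have [L [x [st _]]] := @maximal_path _ _ _ mn rm.
  have [s [gs sz tr]] := steps_green hn start_tracks st.
  exists s; split; last by rewrite sz; lia.
  rewrite /maximal_green_sequence /green_sequence gs; apply/forallP => -[k kn].
  exact: (@final_not_green _ _ _ _ _ hn tr kn).
Qed.
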